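(* Let $n\ge 2$ and let $T=\varphi(t)\,dt^2+t^2\psi(t)\,d\Theta^2$ be a smooth rotationally symmetric tensor on $\mathbb{R}^n$ that is nonsingular everywhere. Suppose $w$ is a smooth solution, on an interval $[0,a)$ with $0<a\le\infty$, of $$\left(\frac{dw}{dt}\right)^2=\frac{1}{n-1}\left[(n-2)\varphi(t)(w^2-2w)+t^2\varphi(t)\psi(t)\right]$$ such that $w(0)=w'(0)=0$ and $w'(t)\varphi(t)>0$ for $t\in(0,a)$. Then the Ricci system $\mathrm{Ric}(g)=T$ is solvable (on $\{|x|<a\}$). In fact, a solution is $$g=e^{2f(t)}\left[r'(t)^2\,dt^2+r(t)^2\,d\Theta^2\right],$$ where $r$ is a smooth solution of $(n-1)w'r'-\varphi r=0$ with $r(0)=0$, $r'(0)=1$, and $f$ is a smooth solution of $(n-1)w'f'+w\varphi=0$; explicitly, $$r(t)=t\exp\left(\int_0^t\left[\frac{\varphi(s)}{(n-1)w'(s)}-\frac1s\right]ds\right),$$ $$f(t)=-\int_0^t w(s)\frac{r'(s)}{r(s)}\,ds+c=-\int_0^t\frac{\varphi(s)}{n-1}\,\frac{w(s)}{w'(s)}\,ds+c,$$ with $c$ an arbitrary real constant ($c=0$ corresponding to $f(0)=0$).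
   Context: Here $t=|x|\ge 0$ is the Euclidean distance to the origin of $\mathbb{R}^n$, $\Theta=x/|x|\in\mathbb{S}^{n-1}$, and $d\Theta^2$ is the standard metric of the unit sphere $\mathbb{S}^{n-1}$. A symmetric 2-tensor $T$ on $\mathbb{R}^n$ is rotationally symmetric if $\gamma^*T=T$ for every $\gamma\in SO(n)$. Nonsingular means nondegenerate at every point; such a $T$ is either positive or negative definite everywhere, and $\varphi(0)=\psi(0)$. Primes denote $d/dt$. $\mathrm{Ric}(g)$ denotes the Ricci tensor of $g$ (with the convention that it is positive on round spheres). *)

(* Defs.v *)
From HB Require Import structures.
From mathcomp Require Import all_boot all_order all_algebra.
From mathcomp Require Import all_classical all_reals all_analysis.

Set Implicit Arguments.
Unset Strict Implicit.
Unset Printing Implicit Defensive.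

Import Order.TTheory GRing.Theory Num.Theory.
Import numFieldNormedType.Exports.

Local Open Scope classical_set_scope.
Local Open Scope ring_scope.

(* One-variable calculus relative to an interval: at an end point belonging to
   D the derivative is the one-sided one, at an interior point it is the usual
   one.  Only the values of f on D matter. *)
Definition diff_quotient (R : realType) (f : R -> R) (t s : R) : R :=
  (f s - f t) / (s - t).

Definition derive_in (R : realType) (D : set R) (f : R -> R) (t : R) : R :=
  lim (diff_quotient f t s @[s --> within D t^']).

Definition smooth_in (R : realType) (D : set R) (f : R -> R) : Prop :=
  forall (k : nat) (t : R), D t ->
    cvg (diff_quotient (iter k (derive_in D) f) t s @[s --> within D t^']).

Definition Ico0 (R : realType) (a : \bar R) : set R :=
  [set t : R | 0 <= t /\ (t%:E < a)%E].

(* The library norm on row vectors is the sup norm, hence: *)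
Definition enorm (R : realType) (n : nat) (x : 'rV[R]_n) : R :=
  Num.sqrt (\sum_(i < n) x 0 i ^+ 2).

Definition eball (R : realType) (n : nat) (a : \bar R) : set 'rV[R]_n :=
  [set x | ((enorm x)%:E < a)%E].

Definition partial (R : realType) (n : nat) (i : 'I_n) (F : 'rV[R]_n -> R)
    (x : 'rV[R]_n) : R :=
  derive (F : 'rV[R]_n -> R^o) x (delta_mx 0 i).

(* C^oo on an open set U: every iterated partial derivative exists and is
   continuous on U. *)
Definition smooth_on (R : realType) (n : nat) (U : set 'rV[R]_n)
    (F : 'rV[R]_n -> R) : Prop :=
  forall (s : seq 'I_n) (x : 'rV[R]_n), U x ->
    let G := foldr (@partial R n) F s in
    {for x, continuous G} /\
    forall i : 'I_n, derivable (G : 'rV[R]_n -> R^o) x (delta_mx 0 i).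

(* A (0,2)-tensor field is given by its matrix in Cartesian coordinates,
   T x i j = T_x(e_i, e_j). *)
Definition tensor2 (R : realType) (n : nat) : Type := 'rV[R]_n -> 'M[R]_n.

Definition smooth_tensor (R : realType) (n : nat) (U : set 'rV[R]_n)
    (T : tensor2 R n) : Prop :=
  forall i j : 'I_n, smooth_on U (fun x => T x i j).

Definition symmetric_tensor (R : realType) (n : nat) (U : set 'rV[R]_n)
    (T : tensor2 R n) : Prop :=
  forall x, U x -> (T x)^T = T x.

Definition nonsingular_tensor (R : realType) (n : nat) (U : set 'rV[R]_n)
    (T : tensor2 R n) : Prop :=
  forall x, U x -> T x \in unitmx.

Definition special_orthogonal (R : realType) (n : nat) (A : 'M[R]_n) : Prop :=
  A *m A^T = 1%:M /\ \det A = 1.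

(* Pullback by the linear map x |-> x *m A (vectors are rows). *)
Definition pullback_mx (R : realType) (n : nat) (A : 'M[R]_n)
    (T : tensor2 R n) : tensor2 R n :=
  fun x => A *m T (x *m A) *m A^T.

Definition rotationally_symmetric (R : realType) (n : nat)
    (T : tensor2 R n) : Prop :=
  symmetric_tensor setT T /\
  forall A : 'M[R]_n, special_orthogonal A ->
    forall x, pullback_mx A T x = T x.

(* dt^2 and dTheta^2 away from the origin, for t = |x| and Theta = x / |x|;
   the round metric of the sphere is induced by the Euclidean one, so
   dTheta^2 = \sum_k dTheta_k (x) dTheta_k. *)
Definition dt2 (R : realType) (n : nat) : tensor2 R n := fun x =>
  \matrix_(i, j) (partial i (@enorm R n) x * partial j (@enorm R n) x).

Definition Theta (R : realType) (n : nat) (k : 'I_n) (x : 'rV[R]_n) : R :=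
  x 0 k / enorm x.

Definition dTheta2 (R : realType) (n : nat) : tensor2 R n := fun x =>
  \matrix_(i, j) \sum_(k < n)
    (partial i (@Theta R n k) x * partial j (@Theta R n k) x).

(* S = P(t) dt^2 + Q(t) dTheta^2 on U minus the origin, where alone polar
   coordinates make sense; the value at the origin of a continuous S is then
   determined. *)
Definition polar_form (R : realType) (n : nat) (U : set 'rV[R]_n)
    (S : tensor2 R n) (P Q : R -> R) : Prop :=
  forall x, U x -> x != 0 ->
    S x = P (enorm x) *: dt2 x + Q (enorm x) *: dTheta2 x.

Definition riemannian_metric (R : realType) (n : nat) (U : set 'rV[R]_n)
    (g : tensor2 R n) : Prop :=
  [/\ smooth_tensor U g, symmetric_tensor U g &
      forall x, U x -> forall v : 'rV[R]_n, v != 0 ->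
        0 < (v *m g x *m v^T) 0 0].

(* christoffel g k i j is Gamma^k_{ij} of the Levi-Civita connection. *)
Definition christoffel (R : realType) (n : nat) (g : tensor2 R n)
    (k i j : 'I_n) (x : 'rV[R]_n) : R :=
  2^-1 * \sum_(l < n) invmx (g x) k l *
    (partial i (fun y => g y j l) x + partial j (fun y => g y i l) x
     - partial l (fun y => g y i j) x).

(* The e_l-component of R(e_i, e_j) e_k, where
   R(X, Y) Z = D_X D_Y Z - D_Y D_X Z - D_[X,Y] Z. *)
Definition riemann (R : realType) (n : nat) (g : tensor2 R n)
    (l k i j : 'I_n) (x : 'rV[R]_n) : R :=
  partial i (christoffel g l j k) x - partial j (christoffel g l i k) x
  + \sum_(m < n) (christoffel g l i m x * christoffel g m j k x
                  - christoffel g l j m x * christoffel g m i k x).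

(* Ric(Y, Z) is the trace of X |-> R(X, Y) Z: positive on round spheres. *)
Definition ricci (R : realType) (n : nat) (g : tensor2 R n) : tensor2 R n :=
  fun x => \matrix_(j, k) \sum_(i < n) riemann g i k i j x.

Definition ricci_solution (R : realType) (n : nat) (U : set 'rV[R]_n)
    (T g : tensor2 R n) : Prop :=
  riemannian_metric U g /\ forall x, U x -> ricci g x = T x.

Definition ricci_solvable (R : realType) (n : nat) (U : set 'rV[R]_n)
    (T : tensor2 R n) : Prop :=
  exists g, ricci_solution U T g.

Definition w_solution (R : realType) (n : nat) (a : \bar R)
    (phi psi w : R -> R) : Prop :=
  let w' := derive_in (Ico0 a) w in
  [/\ smooth_in (Ico0 a) w,
      forall t, Ico0 a t ->
        w' t ^+ 2 =
        (n%:R - 1)^-1 * ((n%:R - 2) * phi t * (w t ^+ 2 - 2 * w t)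
                         + t ^+ 2 * phi t * psi t),
      w 0 = 0, w' 0 = 0 &
      forall t, Ico0 a t -> 0 < t -> 0 < w' t * phi t].

Definition r_solution (R : realType) (n : nat) (a : \bar R)
    (phi w r : R -> R) : Prop :=
  let w' := derive_in (Ico0 a) w in
  let r' := derive_in (Ico0 a) r in
  [/\ smooth_in (Ico0 a) r,
      forall t, Ico0 a t -> (n%:R - 1) * w' t * r' t - phi t * r t = 0,
      r 0 = 0 & r' 0 = 1].

Definition f_solution (R : realType) (n : nat) (a : \bar R)
    (phi w f : R -> R) : Prop :=
  let w' := derive_in (Ico0 a) w in
  let f' := derive_in (Ico0 a) f in
  smooth_in (Ico0 a) f /\
  forall t, Ico0 a t -> (n%:R - 1) * w' t * f' t + w t * phi t = 0.

(* The integrands of the explicit formulas are continuous on ]0, a[ and only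
   have removable singularities at s = 0; their conventional value there does
   not affect the integrals. *)
Definition r_integrand (R : realType) (n : nat) (a : \bar R)
    (phi w : R -> R) (s : R) : R :=
  phi s / ((n%:R - 1) * derive_in (Ico0 a) w s) - s^-1.

Definition f_integrand (R : realType) (n : nat) (a : \bar R)
    (phi w : R -> R) (s : R) : R :=
  phi s / (n%:R - 1) * (w s / derive_in (Ico0 a) w s).

Definition fr_integrand (R : realType) (a : \bar R) (w r : R -> R)
    (s : R) : R :=
  w s * (derive_in (Ico0 a) r s / r s).

Definition integral_0to (R : realType) (h : R -> R) (t : R) : R :=
  Rintegral lebesgue_measure `[0, t] h.

Definition integrable_0to (R : realType) (h : R -> R) (t : R) : Prop :=
  lebesgue_measure.-integrable `[0, t] (EFin \o h).

Definition r_explicit (R : realType) (n : nat) (a : \bar R)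
    (phi w : R -> R) (t : R) : R :=
  t * expR (integral_0to (r_integrand n a phi w) t).

Definition f_explicit (R : realType) (n : nat) (a : \bar R)
    (phi w : R -> R) (c t : R) : R :=
  - integral_0to (f_integrand n a phi w) t + c.

(* Main.v *)
(* Write T = phi dt^2 + t^2 psi dTheta^2. Smoothness of T at the origin forces phi
   and psi to be even in t (all odd derivatives at 0 vanish), and the equation for
   w then makes w even as well: w = t^2 z, w' = t y, where the lowest odd Taylor
   coefficient c of z satisfies phi(0) (2k + 1 + n) c = 0. Since (n-1) y(0) = phi(0),
   phi = (n-1) y E with E = 1 + t^2 kap and kap even, so r = t rho with
   rho' / rho = t kap and f' = - t z E. The metric is therefore A (I + kap x x^T)^2
   with A = exp(2 f) rho^2; its coefficients are polynomials in the coordinates and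
   in even functions of |x|, hence smooth. Its Christoffel symbols and Ricci tensor are
   rational in kap, z and their derivatives, without denominators vanishing at the
   origin, and the equation for w becomes psi = y / E + (n-2) (2z - t^2 z^2), the
   coefficient of the identity in the Ricci tensor.

   A smooth even function h is described coinductively: h' = t h_1 with h_1 again
   smooth and even; this yields h(|x|) smooth without composing with a square root. *)

Require Import Defs.
From HB Require Import structures.
From mathcomp Require Import all_boot all_order all_algebra.
From mathcomp Require Import all_classical all_reals all_analysis.
From mathcomp Require Import ring lra.

Set Implicit Arguments.
Unset Strict Implicit.
Unset Printing Implicit Defensive.

Import Order.TTheory GRing.Theory Num.Theory.
Import numFieldNormedType.Exports.

Local Open Scope classical_set_scope.
Local Open Scope ring_scope.

(** * Iterated differentiation on an interval *)

Section Calculus.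
Context (R : realType) (a : \bar R).
Implicit Types (f g h : R -> R) (t : R) (e p : nat).

(** The obstacle is evenness. The solution w is only smooth on the side t >= 0, whereas a tensor
    built from it is smooth at the origin when its profiles are even in t. The equation gives no
    symmetry for free: after division by t^2 it still carries t in front of z', so it is singular at
    0. Its odd Taylor coefficients are therefore compared degree by degree, and the vanishing of all
    of them is turned into evenness in the coinductive sense.

    The factor E = phi / ((n-1) y) is t r' / r, and E(0) = 1 says that the metric has no conical
    point at the origin. This is where the sign condition on w' enters: the rejected root y(0) = -
    phi(0) would give E(0) = - 1/(n-1), incompatible with r(0) = 0, r'(0) = 1. Off the origin, r'^2
    dt^2 + r^2 dTheta^2 is rho^2 (I + ((E^2 - 1) / t^2) x x^T), and E = 1 + t^2 kap makes the
    quotient equal to 2 kap + t^2 kap^2, so the polar singularity disappears and the square (I + kap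
    x x^T)^2 appears. *)

Definition cont f := (forall t, 0 < t -> (t%:E < a)%E -> {for t, continuous f}) /\
  f s @[s --> 0^'+] --> f 0.

(** Nothing is asked at 0: once f and g are continuous there from the right, the mean value theorem
    supplies the one-sided derivative ([cvg_diff_quotient0]). *)
Definition der f g := forall t, 0 < t -> (t%:E < a)%E -> is_derive t 1 f (g t).

Lemma lt_ereal_between t : (t%:E < a)%E -> exists2 b, t < b & (b%:E < a)%E.
Proof.
case: a => [b||] //=; rewrite ?lte_fin => tb.
  exists ((t + b) / 2); rewrite ?lte_fin; lra.
by exists (t + 1); rewrite ?ltry //; lra.
Qed.

Lemma near_Ioo t : 0 < t -> (t%:E < a)%E -> \forall s \near t, 0 < s /\ (s%:E < a)%E.
Proof.
move=> t0 /lt_ereal_between[b tb ba].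
near=> s; split; first by near: s; exact: lt_nbhsr.
by apply: lt_trans ba; rewrite lte_fin; near: s; exact: lt_nbhsl.
Unshelve. all: by end_near. Qed.

Hypothesis a_gt0 : (0 < a)%E.

Lemma near0_Ioo : \forall s \near 0^'+, 0 < s /\ (s%:E < a)%E.
Proof.
have [b tb ba] := lt_ereal_between a_gt0.
near=> s; split; first by near: s; exact: nbhs_right_gt.
by apply: lt_trans ba; rewrite lte_fin; near: s; exact: nbhs_right_lt.
Unshelve. all: by end_near. Qed.

Lemma cont_eq f g : (forall t, 0 <= t -> (t%:E < a)%E -> f t = g t) ->
  cont f -> cont g.
Proof.
move=> fg [fc f0]; split=> [t t0 ta|].
  rewrite /prop_for /continuous_at /= -(fg t (ltW t0) ta).
  apply: cvg_trans (fc t t0 ta); apply: near_eq_cvg.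
  by apply: filterS (near_Ioo t0 ta) => s [s0 sa]; apply: fg => //; exact: ltW.
rewrite -(fg 0 (lexx _) a_gt0); apply: cvg_trans f0; apply: near_eq_cvg.
by apply: filterS near0_Ioo => s [s0 sa]; apply: fg => //; exact: ltW.
Qed.

Lemma der_eq f g f1 g1 :
  (forall t, 0 < t -> (t%:E < a)%E -> f t = g t) ->
  (forall t, 0 < t -> (t%:E < a)%E -> f1 t = g1 t) ->
  der f f1 -> der g g1.
Proof.
move=> fg fg1 df t t0 ta; rewrite -fg1 //.
apply: near_eq_is_derive (df t t0 ta).
by apply: filterS (near_Ioo t0 ta) => s []; exact: fg.
Qed.

Lemma cont_cst (c : R) : cont (fun=> c).
Proof. by split=> [t _ _|]; exact: cvg_cst. Qed.

Lemma cont_id : cont id.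
Proof. by split=> [t _ _|]; [exact: cvg_id | exact/cvg_at_right_filter/cvg_id]. Qed.

Lemma contD f g : cont f -> cont g -> cont (fun t => f t + g t).
Proof.
move=> [fc f0] [gc g0]; split=> [t t0 ta|]; last exact: cvgD.
by apply: cvgD; [exact: fc | exact: gc].
Qed.

Lemma contM f g : cont f -> cont g -> cont (fun t => f t * g t).
Proof.
move=> [fc f0] [gc g0]; split=> [t t0 ta|]; last exact: cvgM.
by apply: cvgM; [exact: fc | exact: gc].
Qed.

Lemma contX f e : cont f -> cont (fun t => f t ^+ e).
Proof.
move=> fc; elim: e => [|e IH]; first exact: cont_cst.
by under eq_fun do rewrite exprS; exact: contM.
Qed.

Lemma contV f : (forall t, 0 <= t -> (t%:E < a)%E -> f t != 0) ->
  cont f -> cont (fun t => (f t)^-1).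
Proof.
move=> fN0 [fc f0]; split=> [t t0 ta|]; last by apply: cvgV => //; exact: fN0.
by apply: cvgV; [apply: fN0 => //; exact: ltW | exact: fc].
Qed.

Lemma cont_expR f : cont f -> cont (fun t => expR (f t)).
Proof.
move=> [fc f0]; split=> [t t0 ta|].
  by apply: continuous_cvg; [exact: continuous_expR | exact: fc].
by apply: continuous_cvg => //; exact: continuous_expR.
Qed.

(* e = 0: smooth on [0, a); e = 1: restriction to [0, a) of a smooth even function. *)
Definition iterable e h := exists S : set (R -> R), S h /\
  forall s, S s -> cont s /\ exists2 s', S s' & der s (fun t => t ^+ e * s' t).

(* The largest set of functions closed under differentiation (up to the weight
   t ^ e) is closed under every operation that generates a closed set. *)
Inductive generated (S : set (R -> R)) : (R -> R) -> Prop :=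
| generated_base h : S h -> generated S h
| generated_cst (c : R) : generated S (fun=> c)
| generatedD f g : generated S f -> generated S g -> generated S (fun t => f t + g t)
| generatedM f g : generated S f -> generated S g -> generated S (fun t => f t * g t)
| generatedV f : (forall t, 0 <= t -> (t%:E < a)%E -> f t != 0) ->
    generated S f -> generated S (fun t => (f t)^-1)
| generated_expR f : generated S f -> generated S (fun t => expR (f t))
| generated_eq f g : (forall t, 0 <= t -> (t%:E < a)%E -> f t = g t) ->
    generated S f -> generated S g.

Lemma iterable_unfold e h : iterable e h ->
  cont h /\ exists2 h', iterable e h' & der h (fun t => t ^+ e * h' t).
Proof.
by move=> [S [Sh SS]]; have [hc [h' Sh' hh']] := SS h Sh; split=> //; exists h' => //; exists S.
Qed.

(** Division of the derivative by t^e still leaves a derivation, so the sum, product, inverse and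
    chain rules keep [generated S0] stable under it. This is coinduction up to closure: the
    derivatives of the base functions may lie in the closure instead of in [S0]. *)
Lemma generated_iterable e (S0 : set (R -> R)) :
  (forall s, S0 s -> cont s /\ exists2 s', generated S0 s' & der s (fun t => t ^+ e * s' t)) ->
  forall h, generated S0 h -> iterable e h.
Proof.
move=> S0P h gh; exists (generated S0); split=> // {h gh}s.
elim=> {s} [s /S0P //|c|f g _ [fc [f' gf' df]] gg [gc [g' gg' dg]]
  |f g gf [fc [f' gf' df]] gg [gc [g' gg' dg]]|f fN0 gf [fc [f' gf' df]]
  |f gf [fc [f' gf' df]]|f g fg gf [fc [f' gf' df]]].
- split; first exact: cont_cst.
  exists (fun=> 0); first exact: generated_cst.
  by move=> t _ _; rewrite mulr0; exact: is_derive_cst.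
- split; first exact: contD.
  exists (fun t => f' t + g' t); first exact: generatedD.
  by move=> t t0 ta; rewrite mulrDr; apply: is_deriveD; [exact: df|exact: dg].
- split; first exact: contM.
  exists (fun t => f t * g' t + g t * f' t); first by apply: generatedD; exact: generatedM.
  move=> t t0 ta; have Hf := df t t0 ta; have Hg := dg t t0 ta.
  by apply: is_derive_eq; rewrite /GRing.scale /=; ring.
- split; first exact: contV.
  exists (fun t => (-1) * ((f t)^-1 * (f t)^-1) * f' t).
    apply: generatedM => //; apply: generatedM; first exact: generated_cst.
    by apply: generatedM; exact: generatedV.
  move=> t t0 ta; have Hf := df t t0 ta.
  apply: (is_derive_eq (is_deriveV _ _)); first by apply: fN0 => //; exact: ltW.
  by rewrite /GRing.scale /= -invfM -expr2; ring.
- split; first exact: cont_expR.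
  exists (fun t => expR (f t) * f' t); first by apply: generatedM => //; exact: generated_expR.
  move=> t t0 ta; have Hf := df t t0 ta.
  apply: (is_derive_eq (is_derive1_comp _ _)).
  by rewrite mulrCA.
- split; first exact: cont_eq fc.
  exists f' => //; apply: der_eq df => // t t0 ta; exact: fg (ltW _) _.
Qed.

Lemma iterable_gen e h : generated (iterable e) h -> iterable e h.
Proof.
apply: generated_iterable => s /iterable_unfold[sc [s' s'i d]]; split=> //.
by exists s' => //; exact: generated_base.
Qed.

Lemma iterable_prim e f g : cont f -> der f (fun t => t ^+ e * g t) -> iterable e g ->
  iterable e f.
Proof.
move=> fc df gi; exists [set h | h = f \/ iterable e h]; split; first by left.
move=> s [->|/iterable_unfold[sc [s' s'i d]]]; split=> //; first by exists g => //; right.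
by exists s' => //; right.
Qed.

Lemma iterable_cst e (c : R) : iterable e (fun=> c).
Proof. exact/iterable_gen/generated_cst. Qed.

Lemma iterable_cont e h : iterable e h -> cont h.
Proof. by case/iterable_unfold. Qed.

Lemma iterable_eq e f g : (forall t, 0 <= t -> (t%:E < a)%E -> f t = g t) ->
  iterable e f -> iterable e g.
Proof. by move=> fg fi; apply: iterable_gen; apply: (generated_eq fg); exact: generated_base. Qed.

Lemma iterableD e f g : iterable e f -> iterable e g -> iterable e (fun t => f t + g t).
Proof. by move=> fi gi; apply/iterable_gen/generatedD; exact: generated_base. Qed.

Lemma iterableM e f g : iterable e f -> iterable e g -> iterable e (fun t => f t * g t).
Proof. by move=> fi gi; apply/iterable_gen/generatedM; exact: generated_base. Qed.

Lemma iterableV e f : (forall t, 0 <= t -> (t%:E < a)%E -> f t != 0) ->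
  iterable e f -> iterable e (fun t => (f t)^-1).
Proof. by move=> f0 fi; apply/iterable_gen/generatedV => //; exact: generated_base. Qed.

Lemma iterable_expR e f : iterable e f -> iterable e (fun t => expR (f t)).
Proof. by move=> fi; apply/iterable_gen/generated_expR; exact: generated_base. Qed.

Lemma iterableZ e (c : R) f : iterable e f -> iterable e (fun t => c * f t).
Proof. by move=> fi; apply: iterableM fi; exact: iterable_cst. Qed.

Lemma iterableB e f g : iterable e f -> iterable e g -> iterable e (fun t => f t - g t).
Proof.
move=> fi /(iterableZ (-1)) gi; apply: iterable_eq (iterableD fi gi) => t _ _ /=; ring.
Qed.

Lemma iterableX e f p : iterable e f -> iterable e (fun t => f t ^+ p).
Proof.
move=> fi; elim: p => [|p IH]; first exact: iterable_cst.
by apply: iterable_eq (iterableM fi IH) => t _ _; rewrite exprS.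
Qed.

Lemma iterable_id : iterable 0 id.
Proof.
apply: (iterable_prim cont_id _ (iterable_cst 0 1)) => t _ _.
by rewrite expr0 mulr1; exact: is_derive_id.
Qed.

Lemma iterable_sqr_id : iterable 1 (fun t => t ^+ 2).
Proof.
apply: (iterable_prim (contX 2 cont_id) _ (iterable_cst 1 2)) => t _ _.
by apply: is_derive_eq; rewrite /GRing.scale /= expr1 mulr1 mulr_natr.
Qed.

(** With [id] added to the base, the derivative t * s' t of an even function is a product of two
    base functions. *)
Lemma even_smooth_iterable h : iterable 1 h -> iterable 0 h.
Proof.
move=> hi; apply: (@generated_iterable 0 (iterable 1 `|` [set id])); last first.
  by apply: generated_base; left.
move=> s [/iterable_unfold[sc [s' s'i d]]|->]; split=> //; last 2 first.
- exact: cont_id.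
- exists (fun=> 1); first exact: generated_cst.
  by move=> t _ _; rewrite mulr1; exact: is_derive_id.
exists (fun t => t * s' t).
  by apply: generatedM; apply: generated_base; [right|left].
by apply: der_eq d => // t _ _; rewrite expr0 mul1r expr1.
Qed.
End Calculus.

(** * One-sided derivatives and removable singularities at 0 *)

Section OneSided.
Context (R : realType) (a : \bar R) (a_gt0 : (0 < a)%E).
Implicit Types (f g h : R -> R) (t : R) (e p : nat).

Lemma is_derive_exprS p t : is_derive t 1 (fun s => s ^+ p.+1) (p.+1%:R * t ^+ p).
Proof.
have -> : (fun s : R => s ^+ p.+1) = id ^+ p.+1 by apply/funext => s; rewrite fctE.
apply: is_derive_eq; rewrite /GRing.scale /=.
by rewrite mulr1.
Qed.

Lemma within_Ico0_pos t : 0 < t -> (t%:E < a)%E -> within (Ico0 a) t^' = t^'.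
Proof.
move=> t0 ta; have D := nbhs_dnbhs (near_Ioo t0 ta).
rewrite eqEsubset; split=> P; last exact: cvg_within.
by apply: filterS2 D => s [s0 sa]; apply; split=> //; exact: ltW.
Qed.

Lemma within_Ico0_0 : within (Ico0 a) 0^' = 0^'+.
Proof.
have D : nbhs (0 : R) [set s | 0 < s -> 0 < s /\ (s%:E < a)%E] by exact: (near0_Ioo a_gt0).
rewrite eqEsubset; split=> P; rewrite /within /at_right /dnbhs /within /=.
  apply: filterS2 D => s /= sP H s0.
  by have [_ sa] := sP s0; apply: H; [rewrite gt_eqF|split=> //; exact: ltW].
by apply: filterS => s H s0 [ss sa]; apply: H; rewrite lt_neqAle eq_sym s0.
Qed.

Lemma near0_ball (P : set R) : (\forall s \near 0^'+, P s) ->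
  exists2 d, 0 < d & forall s, 0 < s < d -> P s.
Proof.
move=> [d /= d0 dP]; exists d => // s /andP[s0 sd]; apply: dP => //=.
by rewrite /ball_ /= sub0r normrN gtr0_norm.
Qed.

Lemma is_derive_diff_quotientP f t (l : R) :
  is_derive t 1 f l <-> diff_quotient f t s @[s --> t^'] --> l.
Proof.
rewrite is_derive1_caratheodory; split=> [[g [gE gc <-]]|fl].
  apply: cvg_trans (cvg_trans (cvg_fmap2 (@nbhs_dnbhs _ t)) gc).
  apply: near_eq_cvg; apply: filterS (nbhs_dnbhs_neq t) => s st.
  by rewrite /diff_quotient gE mulfK // subr_eq0.
exists (fun s => if s == t then l else diff_quotient f t s); split.
- move=> s; case: eqP => [->|/eqP st]; first by rewrite !subrr mulr0.
  by rewrite /diff_quotient divfK // subr_eq0.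
- rewrite /prop_for /continuous_at /= eqxx => P Pl.
  rewrite dnbhsE; split; last first.
    by apply/principal_filterP; rewrite /= eqxx; exact: nbhs_singleton.
  move: (fl P Pl); apply: filterS2 (nbhs_dnbhs_neq t) => s st /=.
  by rewrite (negbTE st).
- by rewrite eqxx.
Qed.

(** Cauchy's mean value theorem for [N] against t^(p+1): the factor c^p cancels and N(s) / s^(p+1) =
    G(c) / (p+1) for some 0 < c < s. *)
Lemma cvg_primitive_div p (N G : R -> R) : cont a N -> cont a G -> N 0 = 0 ->
  der a N (fun t => t ^+ p * G t) ->
  N s / s ^+ p.+1 @[s --> 0^'+] --> G 0 / p.+1%:R.
Proof.
move=> [Nc Nc0] [Gc Gc0] N0 dN.
have G1 : G s / p.+1%:R @[s --> 0^'+] --> G 0 / p.+1%:R by apply: cvgMl.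
apply/cvgrPdist_lt => eps eps0.
move/cvgrPdist_lt: G1 => /(_ _ eps0)/near0_ball[d d0 Hd].
have [d' d'0 Hd'] := near0_ball (near0_Ioo a_gt0).
near=> s.
have s0 : 0 < s by near: s; exact: nbhs_right_gt.
have sd : s < d by near: s; exact: nbhs_right_lt.
have sd' : s < d' by near: s; exact: nbhs_right_lt.
have sa : (s%:E < a)%E by apply: (Hd' s _).2; rewrite s0.
have ra r : r \in `]0, s[ -> 0 < r /\ (r%:E < a)%E.
  rewrite in_itv /= => /andP[r0 rs]; split=> //.
  by apply: lt_trans sa; rewrite lte_fin.
have [c cs E] : exists2 c, c \in `]0, s[%R &
    (c ^+ p * G c) / (p.+1%:R * c ^+ p) = (N s - N 0) / (s ^+ p.+1 - 0 ^+ p.+1).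
  apply: (@cauchy_MVT R N (fun c => c ^+ p * G c) (fun x => x ^+ p.+1)
    (fun c => p.+1%:R * c ^+ p) 0 s s0).
  - apply/(continuous_within_itvP _ s0); split=> //.
      by move=> r /ra[]; exact: Nc.
    exact/cvg_at_left_filter/Nc.
  - apply: continuous_subspaceT => r; exact: exprn_continuous.
  - by move=> r /ra[]; exact: dN.
  - by move=> r _; exact: is_derive_exprS.
  - by move=> r /ra[r0 _]; rewrite mulf_neq0 // expf_neq0 // gt_eqF.
have [c0 _] := ra c cs.
have -> : N s / s ^+ p.+1 = G c / p.+1%:R.
  move: E; rewrite N0 subr0 expr0n subr0 => <-.
  have cN0 : c ^+ p != 0 by rewrite expf_neq0 // gt_eqF.
  have : p.+1%:R != 0 :> R by rewrite pnatr_eq0.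
  by move: (p.+1%:R) => q qN0; field; rewrite cN0 qN0.
apply: Hd; rewrite c0 /=; apply: lt_trans sd.
by move: cs; rewrite in_itv /= => /andP[].
Unshelve. all: by end_near. Qed.

Lemma cvg_diff_quotient0 f g : cont a f -> cont a g -> der a f g ->
  diff_quotient f 0 s @[s --> 0^'+] --> g 0.
Proof.
move=> fc gc df.
have H : der a (fun t => f t - f 0) (fun t => t ^+ 0 * g t).
  move=> t t0 ta; have Hf := df t t0 ta; apply: is_derive_eq.
  by rewrite subr0 expr0 mul1r.
have -> : g 0 = g 0 / 1%:R by rewrite divr1.
have fc' : cont a (fun t => f t - f 0) by apply: contD => //; exact: cont_cst.
apply: cvg_trans (cvg_primitive_div fc' gc (subrr _) H).
by apply: near_eq_cvg; apply: nearW => s; rewrite /diff_quotient expr1 subr0.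
Qed.

(* Dividing a primitive of t ^ p * G by t ^ p.+1 removes the singularity at 0;
   the derivative of such a quotient is again of this form, with p + e + 1. *)
Lemma iterable_primitive_div e p (N G Q : R -> R) : cont a N -> iterable a e G ->
  N 0 = 0 -> der a N (fun t => t ^+ p * G t) ->
  (forall t, 0 < t -> (t%:E < a)%E -> Q t = N t / t ^+ p.+1) ->
  Q 0 = G 0 / p.+1%:R -> iterable a e Q.
Proof.
move=> Nc Gi N0 dN QE Q0.
exists [set Q | exists p N G, [/\ cont a N, iterable a e G, N 0 = 0 &
  [/\ der a N (fun t => t ^+ p * G t),
  (forall t, 0 < t -> (t%:E < a)%E -> Q t = N t / t ^+ p.+1) &
  Q 0 = G 0 / p.+1%:R]]]; split; first by exists p, N, G.
move=> {p N G Q Nc Gi N0 dN QE Q0} Q [p [N [G [Nc Gi N0 [dN QE Q0]]]]].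
have Gc := iterable_cont Gi.
split.
  split=> [t t0 ta|]; last first.
    rewrite Q0; apply: cvg_trans (cvg_primitive_div Nc Gc N0 dN).
    by apply: near_eq_cvg; apply: filterS (near0_Ioo a_gt0) => s [s0 sa]; rewrite QE.
  rewrite /prop_for /continuous_at QE //.
  have : N s / s ^+ p.+1 @[s --> t] --> N t / t ^+ p.+1.
    apply: cvgM; first exact: Nc.1.
    by apply: cvgV; [rewrite expf_neq0 // gt_eqF | exact: exprn_continuous].
  apply: cvg_trans; apply: near_eq_cvg.
  by apply: filterS (near_Ioo t0 ta) => s [s0 sa]; rewrite QE.
have [_ [G' G'i dG]] := iterable_unfold Gi.
(* The derivative of N / t^(p+1) is N1 / t^(p+2). In the derivative of [N1] the terms in t^p G
   cancel and t^(p+1+e) G' remains. Splitting off the weight t^e raises the exponent of the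
   denominator to p+e+2, one more than p+1+e. *)
pose N1 t := t ^+ p.+1 * G t - p.+1%:R * N t.
exists (fun t => if t == 0 then G' 0 / (p.+1 + e).+1%:R else N1 t / t ^+ (p.+1 + e).+1).
  exists (p.+1 + e)%N, N1, G'; split => //.
  - apply: contD; first by apply: contM Gc; exact/contX/cont_id.
    by under eq_fun do rewrite -mulNr; apply: contM Nc; exact: cont_cst.
  - by rewrite /N1 N0 expr0n mul0r mulr0 subr0.
  split; last by rewrite eqxx.
    move=> t t0 ta; have HG := dG t t0 ta; have HN := dN t t0 ta.
    have HX := is_derive_exprS p t.
    by apply: is_derive_eq; rewrite /GRing.scale /= exprD exprS; ring.
  by move=> t t0 _; rewrite gt_eqF.
apply: (der_eq (f := fun t => N t / t ^+ p.+1)); first by move=> t t0 ta; rewrite QE.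
  by move=> t t0 ta; exact: erefl.
move=> t t0 ta; have HN := dN t t0 ta; rewrite gt_eqF //.
have tN0 : t != 0 by rewrite gt_eqF.
have HV : is_derive t 1 (fun t => (t ^+ p.+1)^-1) (- (t ^+ p.+1) ^- 2 *: (p.+1%:R * t ^+ p)).
  by apply: is_deriveV; [rewrite expf_neq0 | exact: is_derive_exprS].
apply: is_derive_eq; rewrite /GRing.scale /= /N1.
rewrite !exprS exprD.
by field; rewrite tN0 !expf_neq0.
Qed.
End OneSided.

Ltac iterable :=
  first [ assumption
        | exact: iterable_cst | exact: iterable_id | exact: iterable_sqr_id
        | apply: even_smooth_iterable; assumption
        | apply: iterableB; [assumption | iterable | iterable]
        | apply: iterableD; [assumption | iterable | iterable]
        | apply: iterableM; [assumption | iterable | iterable]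
        | apply: iterableX; [assumption | iterable]
        | apply: iterable_expR; [assumption | iterable] ].

(** * Agreement with smoothness by iterated difference quotients; division at 0 *)

Section SmoothIn.
Context (R : realType) (a : \bar R) (a_gt0 : (0 < a)%E).
Implicit Types (f g h : R -> R) (t : R) (k : nat).
Local Notation smooth := (iterable a 0).
Local Notation even_smooth := (iterable a 1).

Lemma der_unique f g g' : der a f g -> der a f g' ->
  forall t, 0 < t -> (t%:E < a)%E -> g t = g' t.
Proof.
move=> dg dg' t t0 ta; rewrite -(@derive_val _ _ _ _ _ _ _ (dg t t0 ta)).
by rewrite (@derive_val _ _ _ _ _ _ _ (dg' t t0 ta)).
Qed.

Lemma cont_eq0 f g : cont a f -> cont a g ->
  (forall t, 0 < t -> (t%:E < a)%E -> f t = g t) -> f 0 = g 0.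
Proof.
move=> [_ f0] [_ g0] fg; apply: cvg_unique f0 _ => //.
apply: cvg_trans g0; apply: near_eq_cvg.
by apply: filterS (near0_Ioo a_gt0) => s [s0 sa]; rewrite fg.
Qed.

Lemma cont_eq_Ico f g : cont a f -> cont a g ->
  (forall t, 0 < t -> (t%:E < a)%E -> f t = g t) ->
  forall t, 0 <= t -> (t%:E < a)%E -> f t = g t.
Proof.
move=> fc gc fg t; rewrite le_eqVlt => /predU1P[<- _|]; last exact: fg.
exact: cont_eq0.
Qed.

Lemma cvg_diff_quotient_in f g : cont a f -> cont a g -> der a f g ->
  forall t, Ico0 a t -> diff_quotient f t s @[s --> within (Ico0 a) t^'] --> g t.
Proof.
move=> fc gc fg t [+ ta]; rewrite le_eqVlt => /predU1P[<-|t0].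
  by rewrite (within_Ico0_0 a_gt0); exact: (cvg_diff_quotient0 a_gt0 fc gc fg).
by rewrite within_Ico0_pos //; apply/is_derive_diff_quotientP/fg.
Qed.

Lemma derive_inE f g : cont a f -> cont a g -> der a f g ->
  forall t, Ico0 a t -> derive_in (Ico0 a) f t = g t.
Proof.
move=> fc gc fg t ta; have H := cvg_diff_quotient_in fc gc fg ta.
apply: cvg_lim H => //; case: ta => + ta.
rewrite le_eqVlt => /predU1P[<-|t0].
  by rewrite (within_Ico0_0 a_gt0); exact: at_right_proper_filter.
by rewrite within_Ico0_pos //; exact: Proper_dnbhs_numFieldType.
Qed.

Lemma smooth_der h : smooth h -> der a h (derive_in (Ico0 a) h) /\
  smooth (derive_in (Ico0 a) h).
Proof.
case/(iterable_unfold) => hc [h' h'i dh].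
have dh' : der a h h' by apply: der_eq dh => // t _ _; rewrite expr0 mul1r.
have E t : 0 <= t -> (t%:E < a)%E -> h' t = derive_in (Ico0 a) h t.
  by move=> t0 ta; rewrite (derive_inE hc (iterable_cont h'i) dh').
split; last apply: (iterable_eq a_gt0 E h'i).
by apply: der_eq dh' => // t t0 ta; apply: E => //; exact: ltW.
Qed.

Lemma smooth_smooth_in h : smooth h -> smooth_in (Ico0 a) h.
Proof.
move=> hi k; have : smooth (iter k (derive_in (Ico0 a)) h).
  by elim: k => //= k /smooth_der[].
move: (iter _ _ _) => g gi t ta; have [dg g'i] := smooth_der gi.
apply/cvg_ex; exists (derive_in (Ico0 a) g t).
exact: (cvg_diff_quotient_in (iterable_cont gi) (iterable_cont g'i) dg ta).
Qed.

Lemma smooth_in_smooth h : smooth_in (Ico0 a) h -> smooth h.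
Proof.
move=> hs; exists [set g | exists k, g = iter k (derive_in (Ico0 a)) h].
split; first by exists 0.
move=> _ [k ->]; have := hs k; set g := iter k _ h => gs.
have dg : der a g (derive_in (Ico0 a) g).
  move=> t t0 ta; apply/is_derive_diff_quotientP.
  have := gs t (conj (ltW t0) ta); rewrite /derive_in within_Ico0_pos //.
split; last first.
  exists (derive_in (Ico0 a) g); first by exists k.+1.
  by apply: der_eq dg => // t _ _; rewrite expr0 mul1r.
split=> [t t0 ta|].
  by have [gd _] := dg t t0 ta; apply/differentiable_continuous/derivable1_diffP.
have := gs 0 (conj (lexx _) a_gt0); rewrite (within_Ico0_0 a_gt0) => g0.
have H : g 0 + diff_quotient g 0 s * s @[s --> 0^'+] -->
    g 0 + lim (diff_quotient g 0 s @[s --> 0^'+]) * 0.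
  by apply: cvgD; [exact: cvg_cst | apply: cvgM => //; exact/cvg_at_right_filter/cvg_id].
rewrite mulr0 addr0 in H; apply: cvg_trans H; apply: near_eq_cvg.
apply: filterS (near0_Ioo a_gt0) => s [s0 _].
by rewrite /diff_quotient subr0 divfK ?gt_eqF // addrC subrK.
Qed.

Lemma smooth_hadamard f f' : cont a f -> smooth f' -> der a f f' -> f 0 = 0 ->
  exists2 q, smooth q & q 0 = f' 0 /\
    forall t, 0 <= t -> (t%:E < a)%E -> f t = t * q t.
Proof.
move=> fc f'i df f0.
pose q t := if t == 0 then f' 0 else f t / t; exists q.
  apply: (iterable_primitive_div a_gt0 (p := 0) fc f'i f0).
  - by apply: der_eq df => // t _ _; rewrite expr0 mul1r.
  - by move=> t t0 _; rewrite /q gt_eqF.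
  - by rewrite /q eqxx divr1.
rewrite /q; split=> [|t _ _]; first by rewrite eqxx.
by case: eqP => [->|/eqP t0]; [rewrite f0 mul0r | rewrite mulrC divfK].
Qed.

Lemma smooth_expand h : smooth h -> exists2 q, smooth q &
  forall t, 0 <= t -> (t%:E < a)%E -> h t = h 0 + t * q t.
Proof.
move=> hi; have [dh h'i] := smooth_der hi.
have [|||q qi [_ qE]] := @smooth_hadamard (fun t => h t - h 0) _ _ h'i.
- by apply: iterable_cont (_ : smooth _); iterable.
- by move=> t t0 ta; have := dh t t0 ta => H; apply: is_derive_eq; rewrite subr0.
- by rewrite subrr.
by exists q => // t t0 ta; rewrite -qE // addrC subrK.
Qed.

(** The function h - h(0) is a primitive of t * h', so division by t^2 is the case p = 1 of
    [iterable_primitive_div], which keeps the weight and hence evenness. *)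
Lemma even_smooth_expand h : even_smooth h -> exists2 q, even_smooth q &
  forall t, 0 <= t -> (t%:E < a)%E -> h t = h 0 + t ^+ 2 * q t.
Proof.
move=> hi; have [hc [h' h'i dh]] := iterable_unfold hi.
pose q t := if t == 0 then h' 0 / 2 else (h t - h 0) / t ^+ 2; exists q.
  apply: (iterable_primitive_div a_gt0 (p := 1) (N := fun t => h t - h 0) _ h'i).
  - by apply: (iterable_cont (e := 1)); iterable.
  - by rewrite subrr.
  - by move=> t t0 ta; have := dh t t0 ta => H; apply: is_derive_eq; rewrite subr0.
  - by move=> t t0 _; rewrite /q gt_eqF.
  - by rewrite /q eqxx.
move=> t _ _; rewrite /q.
case: eqP => [->|/eqP t0]; first by rewrite expr0n mul0r addr0.
by rewrite mulrC divfK ?expf_neq0 // addrC subrK.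
Qed.
End SmoothIn.

(** * Odd Taylor coefficients at the origin *)

Section OddJet.
Context (R : realType) (a : \bar R) (a_gt0 : (0 < a)%E).
Implicit Types (f g h e Q z : R -> R) (c d t : R) (k : nat).
Local Notation smooth := (iterable a 0).
Local Notation even_smooth := (iterable a 1).

(* Modulo even functions, h vanishes to order 2k at 0 and c is its coefficient
   of degree 2k + 1. *)
Definition odd_jet k h c := exists e Q, [/\ even_smooth e, smooth Q &
  forall t, 0 <= t -> (t%:E < a)%E -> h t = e t + t ^+ k.*2.+1 * (c + t * Q t)].

Lemma odd_jet_even k h : even_smooth h -> odd_jet k h 0.
Proof.
move=> hi; exists h, (fun=> 0); split=> //; first exact: iterable_cst.
by move=> t _ _; rewrite mulr0 addr0 mulr0 addr0.
Qed.

Lemma odd_jet_eq k f g c : (forall t, 0 <= t -> (t%:E < a)%E -> f t = g t) ->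
  odd_jet k f c -> odd_jet k g c.
Proof.
move=> fg [e [Q [ei Qi E]]]; exists e, Q; split=> // t t0 ta.
by rewrite -fg // E.
Qed.

Lemma odd_jetD k f g c d : odd_jet k f c -> odd_jet k g d ->
  odd_jet k (fun t => f t + g t) (c + d).
Proof.
move=> [e [Q [ei Qi E]]] [e' [Q' [e'i Q'i E']]].
exists (fun t => e t + e' t), (fun t => Q t + Q' t); split; [iterable|iterable|].
by move=> t t0 ta; rewrite E // E' //; ring.
Qed.

(** A term of degree 2k+1 meets only the value at 0 of the other factor: the rest of an even part
    has a factor t^2, and the product of the two odd parts has a factor t^(4k+2). Both go into the
    remainder. *)
Lemma odd_jetM k f g c d : odd_jet k f c -> odd_jet k g d ->
  odd_jet k (fun t => f t * g t) (c * g 0 + d * f 0).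
Proof.
move=> [e [Q [ei Qi E]]] [e' [Q' [e'i Q'i E']]].
have [q qi qE] := even_smooth_expand a_gt0 ei.
have [q' q'i q'E] := even_smooth_expand a_gt0 e'i.
exists (fun t => e t * e' t), (fun t => Q t * e' t + Q' t * e t +
   c * (t * q' t) + d * (t * q t) + t ^+ k.*2 * (c + t * Q t) * (d + t * Q' t)).
split; [iterable|iterable|].
have f0 : f 0 = e 0 by rewrite E // exprS !mul0r addr0.
have g0 : g 0 = e' 0 by rewrite E' // exprS !mul0r addr0.
move=> t t0 ta; rewrite f0 g0 E // E' // !exprS (qE t) // (q'E t) //.
ring.
Qed.

Lemma odd_jetZ k f c d : odd_jet k f c -> odd_jet k (fun t => d * f t) (d * c).
Proof.
move=> [e [Q [ei Qi E]]]; exists (fun t => d * e t), (fun t => d * Q t).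
split; [iterable|iterable|] => t t0 ta; rewrite E //; ring.
Qed.

Lemma odd_jet_der k h h' c : odd_jet k h c -> der a h h' ->
  exists e Q, [/\ even_smooth e, smooth Q & forall t, 0 < t -> (t%:E < a)%E ->
    h' t = t * e t + t ^+ k.*2 * (k.*2.+1%:R * c + t * Q t)].
Proof.
move=> [e [Q [ei Qi E]]] dh.
have [ec [e1 e1i de]] := iterable_unfold ei.
have [Qc [Q1 Q1i dQ]] := iterable_unfold Qi.
exists e1, (fun t => k.*2.+2%:R * Q t + t * Q1 t); split=> //; first by iterable.
have dh1 : der a h (fun t => t * e1 t + t ^+ k.*2 *
    (k.*2.+1%:R * c + t * (k.*2.+2%:R * Q t + t * Q1 t))).
  apply: (der_eq (f := fun t => e t + t ^+ k.*2.+1 * (c + t * Q t))).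
  - by move=> t t0 ta; rewrite E // ltW.
  - by move=> t t0 ta; exact: erefl.
  - move=> t t0 ta; have He := de t t0 ta; have HQ := dQ t t0 ta.
    have HX := is_derive_exprS k.*2 t.
    apply: is_derive_eq; rewrite /GRing.scale /= expr0 expr1 exprS.
    ring.
by move=> t t0 ta; exact: (der_unique dh dh1).
Qed.

(** The even part is moved to the left. An even function equal to t^(2k+1) (c + t Q) vanishes at 0,
    so it can be divided by t^2 within the even functions, which lowers k. At k = 0, division by t
    leaves t q = c + t Q, to be read at 0. *)
Lemma odd_jet_uniq k h c : even_smooth h -> odd_jet k h c -> c = 0.
Proof.
move=> hi [e [Q [ei Qi E]]].
have [e' e'i {E}E] : exists2 e', even_smooth e' &
    forall t, 0 <= t -> (t%:E < a)%E -> e' t = t ^+ k.*2.+1 * (c + t * Q t).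
  exists (fun t => h t - e t); first by iterable.
  by move=> t t0 ta; rewrite E // addrC addKr.
move: e' e'i E => {ei hi h}e ei E.
have Hc : cont a (fun t => c + t * Q t) by apply: (iterable_cont (e := 0)); iterable.
elim: k e ei E => [|k IH] e ei E; have [q qi qE] := even_smooth_expand a_gt0 ei.
all: have e0 : e 0 = 0 by rewrite E // exprS !mul0r.
  have := cont_eq0 a_gt0 (f := fun t => t * q t) _ Hc.
  rewrite mul0r mul0r addr0 => <- //.
    by apply: (iterable_cont (e := 0)); iterable.
  move=> t t0 ta; have := E t (ltW t0) ta; rewrite qE ?ltW // e0 add0r expr1 expr2 -mulrA.
  by apply: mulfI; rewrite gt_eqF.
apply: (IH q qi); apply: cont_eq_Ico => //; first exact: iterable_cont qi.
  by apply: (iterable_cont (e := 0)); iterable.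
move=> t t0 ta; have := E t (ltW t0) ta; rewrite qE ?ltW // e0 add0r doubleS -(addn2 k.*2.+1).
rewrite exprD -mulrA mulrCA.
by apply: mulfI; rewrite expf_neq0 // gt_eqF.
Qed.

Lemma odd_jet0 h : smooth h -> exists c, odd_jet 0 h c.
Proof.
move=> hi; have [q qi qE] := smooth_expand a_gt0 hi.
have [q1 q1i q1E] := smooth_expand a_gt0 qi.
exists (q 0), (fun=> h 0), q1; split=> //; first exact: iterable_cst.
by move=> t t0 ta; rewrite qE // q1E // expr1.
Qed.

(** Once the coefficient of degree 2k+1 is zero, the next term is Q(0) t^(2k+2), which is even and
    joins [e]; the term after it supplies the new coefficient. *)
Lemma odd_jetS k h : odd_jet k h 0 -> exists c, odd_jet k.+1 h c.
Proof.
move=> [e [Q [ei Qi E]]]; have [q qi qE] := smooth_expand a_gt0 Qi.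
have [q1 q1i q1E] := smooth_expand a_gt0 qi.
exists (q 0), (fun t => e t + (t ^+ 2) ^+ k.+1 * Q 0), q1; split=> //; first by iterable.
move=> t t0 ta; rewrite E // qE // q1E // -exprM mul2n doubleS !exprS; ring.
Qed.

(** Each k comes with its own even part, so no single jet shows that h is even; coinduction does.
    The jet of index 0 gives h'(0) = 0, whence h' = t q, and the jet of index k+1 of h,
    differentiated and divided by t, is the jet of index k of q with coefficient 0 again. *)
Lemma odd_jet_even_smooth h : smooth h -> (forall k, odd_jet k h 0) -> even_smooth h.
Proof.
move=> hi hJ; exists [set h | smooth h /\ forall k, odd_jet k h 0]; split=> //.
move=> {hi hJ} h [hi hJ]; have [dh h'i] := smooth_der a_gt0 hi.
move: (derive_in _ h) dh h'i => h' dh h'i.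
split; first exact: iterable_cont hi.
have h'0 : h' 0 = 0.
  have [e [Q [ei Qi E]]] := odd_jet_der (hJ 0) dh.
  rewrite (cont_eq0 a_gt0 (iterable_cont h'i)
    (g := fun t => t * e t + t ^+ 0 * (1 * 0 + t * Q t))) //.
    by rewrite expr0; ring.
  by apply: (iterable_cont (e := 0)); iterable.
have [_ h''i] := smooth_der a_gt0 h'i.
have [q qi qE] := smooth_expand a_gt0 h'i.
exists q; last first.
  by apply: der_eq dh => // t t0 ta; rewrite qE ?ltW // h'0 add0r expr1.
split=> // k; have [e [Q [ei Qi E]]] := odd_jet_der (hJ k.+1) dh.
exists e, Q; split=> //.
apply: cont_eq_Ico => //; first exact: iterable_cont qi.
  by apply: (iterable_cont (e := 0)); iterable.
move=> t t0 ta; have := E t t0 ta; rewrite qE ?ltW // h'0 mulr0 !add0r.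
rewrite doubleS (exprS _ k.*2.+1) -mulrA -mulrDr.
by apply: mulfI; rewrite gt_eqF.
Qed.

(** Two differentiations take the index k+1 to k and multiply c by (2k+2)(2k+3). Thus c is the
    derivative of order 2k+1 at 0 up to a nonzero factor. *)
Lemma odd_jet_coef k (H : nat -> R -> R) c : (forall j, cont a (H j)) ->
  (forall j, der a (H j) (H j.+1)) -> odd_jet k (H 0) c ->
  H k.*2.+1 0 = 0 -> c = 0.
Proof.
elim: k H c => [|k IH] H c Hc dH J H0.
  have [e [Q [ei Qi E]]] := odd_jet_der J (dH 0).
  move: H0; rewrite (cont_eq0 a_gt0 (Hc 1)
    (g := fun t => t * e t + t ^+ 0 * (1 * c + t * Q t))) //.
    by rewrite expr0 => <-; ring.
  by apply: (iterable_cont (e := 0)); iterable.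
have [e [Q [ei Qi E]]] := odd_jet_der J (dH 0).
have [ec [e1 e1i de]] := iterable_unfold ei.
have [Qc [Q1 Q1i dQ]] := iterable_unfold Qi.
suff /eqP : k.*2.+2%:R * (k.*2.+3%:R * c) = 0 by rewrite !mulf_eq0 !pnatr_eq0 /= => /eqP.
have H2i (s : R -> R) : (forall t, 0 < t -> (t%:E < a)%E -> H 2 t = s t) -> smooth s ->
    forall t, 0 <= t -> (t%:E < a)%E -> H 2 t = s t.
  by move=> Hs si; apply: cont_eq_Ico => //; exact: iterable_cont si.
apply: (IH (fun j => H j.+2)) => //.
exists (fun t => e t + t ^+ 2 * e1 t), (fun t => k.*2.+3%:R * Q t + t * Q1 t).
split; [iterable|iterable|].
apply: H2i; last by iterable.
have d2 : der a (H 1) (fun t => e t + t ^+ 2 * e1 t + t ^+ k.*2.+1 *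
   (k.*2.+2%:R * (k.*2.+3%:R * c) + t * (k.*2.+3%:R * Q t + t * Q1 t))).
  apply: (der_eq (f := fun t => t * e t + t ^+ k.*2.+2 * (k.*2.+3%:R * c + t * Q t))).
  - by move=> t t0 ta; rewrite E.
  - by move=> t t0 ta; exact: erefl.
  - move=> t t0 ta; have He := de t t0 ta; have HQ := dQ t t0 ta.
    have HX := is_derive_exprS k.*2.+1 t.
    apply: is_derive_eq; rewrite /GRing.scale /= expr0 expr1 !exprS.
    ring.
by move=> t t0 ta; exact: (der_unique (dH 1%N) d2).
Qed.

Lemma even_smooth_chain (H : nat -> R -> R) : (forall j, cont a (H j)) ->
  (forall j, der a (H j) (H j.+1)) -> (forall j, odd j -> H j 0 = 0) ->
  even_smooth (H 0).
Proof.
move=> Hc dH Hodd.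
have Hi : smooth (H 0).
  exists [set h | exists j, h = H j]; split; first by exists 0.
  move=> _ [j ->]; split=> //; exists (H j.+1); first by exists j.+1.
  by apply: der_eq (dH j) => // t _ _; rewrite expr0 mul1r.
apply: odd_jet_even_smooth => // k.
suff [c J] : exists c, odd_jet k (H 0) c.
  by rewrite -(odd_jet_coef Hc dH J) // Hodd //= odd_double.
elim: k => [|k [c J]]; first exact: odd_jet0.
by apply: odd_jetS; rewrite -(odd_jet_coef Hc dH J) // Hodd //= odd_double.
Qed.
End OddJet.

(** * The equation for w *)

Section WFactorization.
Context (R : realType) (a : \bar R) (a_gt0 : (0 < a)%E).
Implicit Types (f g : R -> R) (t : R).
Local Notation smooth := (iterable a 0).
Local Notation even_smooth := (iterable a 1).

Lemma cont_ge0 f : cont a f -> (forall t, 0 < t -> (t%:E < a)%E -> 0 < f t) -> 0 <= f 0.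
Proof.
move=> [_ f0] fp; have <- := cvg_lim (@Rhausdorff R) f0.
apply: limr_ge; first exact: cvgP f0.
by apply: filterS (near0_Ioo a_gt0) => s [s0 sa]; exact/ltW/fp.
Qed.

Context (n : nat) (n_ge2 : (2 <= n)%N) (phi psi w : R -> R).
Hypotheses (phi_even : even_smooth phi) (psi_even : even_smooth psi).
Hypotheses (phi0 : phi 0 != 0) (psi0 : phi 0 = psi 0).
Hypothesis w_sol : w_solution n a phi psi w.
Local Notation m := (n%:R : R).

Lemma dimension_ge2 : 2 <= m. Proof. by rewrite ler_nat. Qed.

(* w = t^2 z and w' = t y; at t = 0 the equation for w has the two roots
   y = phi / (n - 1) and y = - phi, and the sign condition excludes the second. *)
Lemma w_divided : exists z z', [/\ smooth z, smooth z', der a z z' &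
  [/\ forall t, 0 <= t -> (t%:E < a)%E -> w t = t ^+ 2 * z t,
  forall t, 0 <= t -> (t%:E < a)%E -> derive_in (Ico0 a) w t = t * (2 * z t + t * z' t),
  forall t, 0 <= t -> (t%:E < a)%E -> (2 * z t + t * z' t) ^+ 2 =
    (m - 1)^-1 * ((m - 2) * (phi t * (t ^+ 2 * z t ^+ 2 - 2 * z t)) + phi t * psi t),
  forall t, 0 < t -> (t%:E < a)%E -> 0 < (2 * z t + t * z' t) * phi t &
  2 * z 0 = phi 0 / (m - 1)]].
Proof.
have m2 := dimension_ge2.
case: w_sol => /(smooth_in_smooth a_gt0) wi ode w0 w'0 w_sgn.
have [dw w'i] := smooth_der a_gt0 wi.
have [q qi [q0 qE]] := smooth_hadamard a_gt0 (iterable_cont wi) w'i dw w0.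
rewrite w'0 in q0; have [dq q'i] := smooth_der a_gt0 qi.
have [z zi [_ zE]] := smooth_hadamard a_gt0 (iterable_cont qi) q'i dq q0.
have [dz z'i] := smooth_der a_gt0 zi.
move: (derive_in _ z) dz z'i => z' dz z'i.
have wE t : 0 <= t -> (t%:E < a)%E -> w t = t ^+ 2 * z t.
  by move=> t0 ta; rewrite qE // zE // mulrA -expr2.
have w'E t : 0 <= t -> (t%:E < a)%E -> derive_in (Ico0 a) w t = t * (2 * z t + t * z' t).
  move: t; apply: cont_eq_Ico => //; first exact: iterable_cont w'i.
    by apply: (iterable_cont (e := 0)); iterable.
  apply: (der_unique dw); apply: (der_eq (f := fun t => t ^+ 2 * z t)).
  - by move=> t t0 ta; rewrite wE // ltW.
  - by move=> t t0 ta; exact: erefl.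
  - move=> t t0 ta; have Hz := dz t t0 ta; have HX := is_derive_exprS 1 t.
    by apply: is_derive_eq; rewrite /GRing.scale /= expr1; ring.
have yphi t : 0 < t -> (t%:E < a)%E -> 0 < (2 * z t + t * z' t) * phi t.
  move=> t0 ta; have := w_sgn t (conj (ltW t0) ta) t0.
  by rewrite w'E ?ltW // -mulrA pmulr_rgt0.
have odey : forall t, 0 <= t -> (t%:E < a)%E -> (2 * z t + t * z' t) ^+ 2 =
    (m - 1)^-1 * ((m - 2) * (phi t * (t ^+ 2 * z t ^+ 2 - 2 * z t)) + phi t * psi t).
  apply: cont_eq_Ico => //.
  - by apply: (iterable_cont (e := 0)); iterable.
  - by apply: (iterable_cont (e := 0)); iterable.
  move=> t t0 ta; have := ode t (conj (ltW t0) ta); rewrite w'E ?ltW // wE ?ltW // => H.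
  have t2 : t ^+ 2 != 0 by rewrite expf_neq0 // gt_eqF.
  by apply: (mulfI t2); rewrite -exprMn H; ring.
exists z, z'; split=> //; split=> //.
have m1 : m - 1 != 0 by rewrite subr_eq0 gt_eqF //; lra.
have : ((m - 1) * (2 * z 0) - phi 0) * (2 * z 0 + phi 0) = 0.
  have := odey 0 (lexx _) a_gt0; rewrite !mul0r addr0 expr0n mul0r sub0r -psi0 => H.
  have {}H : (m - 1) * (2 * z 0) ^+ 2 = (m - 2) * (phi 0 * - (2 * z 0)) + phi 0 * phi 0.
    by rewrite H mulVKf.
  have -> : ((m - 1) * (2 * z 0) - phi 0) * (2 * z 0 + phi 0) =
    (m - 1) * (2 * z 0) ^+ 2 + (m - 2) * (2 * z 0) * phi 0 - phi 0 * phi 0 by ring.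
  by rewrite H; ring.
move/eqP; rewrite mulf_eq0 => /orP[|].
  by rewrite subr_eq0 => /eqP <-; field.
rewrite addr_eq0 => /eqP z0.
(* The strict sign condition holds for t > 0 only, but its limit y(0) phi(0) >= 0 already excludes
   y(0) = - phi(0), since phi(0) is nonzero. *)
have : 0 <= (2 * z 0 + 0 * z' 0) * phi 0.
  apply: (@cont_ge0 (fun t => (2 * z t + t * z' t) * phi t)) => //.
  by apply: (iterable_cont (e := 0)); iterable.
by rewrite mul0r addr0 z0 mulNr oppr_ge0 -expr2 leNgt exprn_even_gt0 //= phi0.
Qed.

Lemma z_even z z' : smooth z -> der a z z' ->
  (forall t, 0 <= t -> (t%:E < a)%E -> (2 * z t + t * z' t) ^+ 2 =
    (m - 1)^-1 * ((m - 2) * (phi t * (t ^+ 2 * z t ^+ 2 - 2 * z t)) + phi t * psi t)) ->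
  2 * z 0 = phi 0 / (m - 1) -> even_smooth z.
Proof.
have m2 := dimension_ge2.
move=> zi dz ode z0; have step k c : odd_jet a k z c -> c = 0.
  move=> Jz; have [e [Q [ei Qi E]]] := odd_jet_der a_gt0 Jz dz.
  have Jtz : odd_jet a k (fun t => t * z' t) (k.*2.+1%:R * c).
    exists (fun t => t ^+ 2 * e t), Q; split=> //; first by iterable.
    move=> t; rewrite le_eqVlt => /predU1P[<- _|t0 ta]; first by rewrite !exprS !mul0r addr0.
    by rewrite E // !exprS; ring.
  have Jy := odd_jetD a_gt0 (odd_jetZ a_gt0 2 Jz) Jtz.
  have Jy2 := odd_jetM a_gt0 Jy Jy.
  have Jt2 := odd_jet_even a_gt0 k (iterable_sqr_id a_gt0).
  have Jt2z2 := odd_jetM a_gt0 Jt2 (odd_jetM a_gt0 Jz Jz).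
  have Jphi := odd_jet_even a_gt0 k phi_even.
  have Jpp := odd_jet_even a_gt0 k (iterableM a_gt0 phi_even psi_even).
  have JR := odd_jetZ a_gt0 (- (m - 1)^-1) (odd_jetD a_gt0 (odd_jetZ a_gt0 (m - 2)
    (odd_jetM a_gt0 Jphi (odd_jetD a_gt0 Jt2z2 (odd_jetZ a_gt0 (- 2) Jz)))) Jpp).
  have H t : 0 <= t -> (t%:E < a)%E ->
     (2 * z t + t * z' t) * (2 * z t + t * z' t) + - (m - 1)^-1 *
     ((m - 2) * (phi t * (t ^+ 2 * (z t * z t) + -2 * z t)) + phi t * psi t) = 0.
    by move=> t0 ta; rewrite -expr2 ode // mulNr -expr2 mulNr subrr.
  have := odd_jet_uniq a_gt0 (iterable_cst a_gt0 1 0)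
    (odd_jet_eq H (odd_jetD a_gt0 Jy2 JR)).
  rewrite z0 expr0n /=; set C := (X in X = 0).
  (* With y(0) = phi(0) / (n-1), the square of y contributes 2 y(0) (2k+3) c, because 2 z + t z'
     multiplies the coefficient by 2 + (2k+1). The term - 2 z on the right contributes 2 (n-2)
     phi(0) c / (n-1) after the change of side, and t^2 z^2 contributes 0. The sum is a positive
     multiple of phi(0) c, so c = 0. *)
  have -> : C = (2 * phi 0 * (k.*2.+1%:R + m) / (m - 1)) * c.
    rewrite /C mulr0n; field; rewrite subr_eq0 gt_eqF //; lra.
  move=> /eqP; rewrite mulf_eq0 => /orP[|/eqP //].
  rewrite !mulf_eq0 invr_eq0 (negbTE phi0) pnatr_eq0 /=.
  have : 0 <= k.*2.+1%:R :> R by exact: ler0n.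
  by move=> k0 /orP[] /eqP; lra.
apply: odd_jet_even_smooth => // k.
suff [c J] : exists c, odd_jet a k z c by rewrite -(step _ _ J).
elim: k => [|k [c J]]; first exact: odd_jet0.
by apply: odd_jetS => //; rewrite -(step _ _ J).
Qed.

Lemma w_factorization : exists z z1 kap, [/\ even_smooth z, even_smooth z1,
  der a z (fun t => t * z1 t), even_smooth kap &
  forall t, 0 <= t -> (t%:E < a)%E ->
    let y := 2 * z t + t ^+ 2 * z1 t in let E := 1 + t ^+ 2 * kap t in
    [/\ w t = t ^+ 2 * z t, derive_in (Ico0 a) w t = t * y,
        phi t = (m - 1) * y * E, psi t = y / E + (m - 2) * (2 * z t - t ^+ 2 * z t ^+ 2) &
        y != 0 /\ 0 < E]].
Proof.
have m2 := dimension_ge2.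
have m1 : m - 1 != 0 by rewrite subr_eq0 gt_eqF //; lra.
have [z [z' [zi z'i dz [wE w'E ode ysgn z0]]]] := w_divided.
have ze := z_even zi dz ode z0.
have [zc [z1 z1i dz1]] := iterable_unfold ze.
have z'E : forall t, 0 <= t -> (t%:E < a)%E -> z' t = t * z1 t.
  apply: cont_eq_Ico => //; first exact: iterable_cont z'i.
    by apply: (iterable_cont (e := 0)); iterable.
  by move=> t t0 ta; rewrite (der_unique dz dz1) // expr1.
pose y t := 2 * z t + t ^+ 2 * z1 t.
have yE t : 0 <= t -> (t%:E < a)%E -> 2 * z t + t * z' t = y t.
  by move=> t0 ta; rewrite z'E // mulrA -expr2.
have yi : even_smooth y by rewrite /y; iterable.
have y0 : y 0 = phi 0 / (m - 1) by rewrite -z0 /y expr0n mul0r addr0.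
have sgn t : 0 <= t -> (t%:E < a)%E -> 0 < y t * phi t.
  rewrite le_eqVlt => /predU1P[<- _|t0 ta]; last by rewrite -yE ?ltW // ysgn.
  rewrite y0 mulrAC -expr2 mulr_gt0 // ?exprn_even_gt0 //= invr_gt0; lra.
have yN0 t : 0 <= t -> (t%:E < a)%E -> y t != 0.
  by move=> t0 ta; apply: contraTneq (sgn t t0 ta) => ->; rewrite mul0r ltxx.
(* The value E(0) = 1 comes from y(0) = phi(0) / (n-1), and evenness then lets [kap] be split off
   with a factor t^2. *)
pose E t := phi t * ((m - 1)^-1 * (y t)^-1).
have Ei : even_smooth E.
  apply: iterableM => //; apply: iterableM => //; first exact: iterable_cst.
  exact: iterableV.
have [kap kapi kapE] := even_smooth_expand a_gt0 Ei.
have E0 : E 0 = 1 by rewrite /E y0; field; rewrite phi0 m1.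
exists z, z1, kap; split=> // t t0 ta.
have -> : 1 + t ^+ 2 * kap t = E t by rewrite kapE // E0.
rewrite -/(y t); move=> /=.
have Ht := yN0 t t0 ta.
have Epos : 0 < E t.
  rewrite /E -invfM; have -> : phi t / ((m - 1) * y t) = (y t * phi t) / ((m - 1) * y t ^+ 2).
    by field; rewrite m1 Ht.
  by rewrite divr_gt0 ?sgn // mulr_gt0 ?exprn_even_gt0 //=; lra.
have phiE : phi t = (m - 1) * y t * E t by rewrite /E; field; rewrite m1 Ht.
split=> //; [exact: wE | by rewrite w'E // yE |].
(* After substitution of phi = (n-1) y E, a nonzero factor (n-1) y cancels and the equation is
   linear in psi: y = E ((n-2) (t^2 z^2 - 2 z) + psi). *)
have := ode t t0 ta; rewrite yE // phiE => H.
have EN0 : E t != 0 by rewrite gt_eqF.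
move: H; move: (E t) (psi t) (y t) EN0 Ht => Et p yt EN0 Ht H.
have {H} : yt ^+ 2 * (m - 1) = (m - 1) * yt * Et * ((m - 2) * (t ^+ 2 * z t ^+ 2 - 2 * z t) + p).
  by rewrite H; field.
have -> : yt ^+ 2 * (m - 1) = ((m - 1) * yt) * yt by ring.
rewrite -[RHS]mulrA => /mulfI H.
rewrite [in RHS]H; last by rewrite mulf_neq0.
by field.
Qed.
End WFactorization.

(** * The functions r and f *)

Section Primitive.
Context (R : realType) (a : \bar R) (a_gt0 : (0 < a)%E).
Implicit Types (f g k : R -> R) (t : R).
Local Notation smooth := (iterable a 0).
Local Notation even_smooth := (iterable a 1).
Local Notation mu := (@lebesgue_measure R).

Lemma cont_within_segment k t : cont a k -> 0 < t -> (t%:E < a)%E ->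
  {within `[0, t], continuous k}.
Proof.
move=> [kc k0] t0 ta; apply/(continuous_within_itvP _ t0); split=> //.
  move=> s; rewrite in_itv /= => /andP[s0 st]; apply: kc => //.
  by apply: lt_trans ta; rewrite lte_fin.
exact/cvg_at_left_filter/kc.
Qed.

Lemma cont_integrable k t : cont a k -> 0 <= t -> (t%:E < a)%E -> integrable_0to k t.
Proof.
move=> kc; rewrite le_eqVlt => /predU1P[<- _|t0 ta].
  apply: continuous_compact_integrable; first exact: segment_compact.
  by rewrite set_itv1; exact: continuous_subspace1.
apply: continuous_compact_integrable; first exact: segment_compact.
exact: cont_within_segment.
Qed.

(** The integrands of the explicit formulas agree with continuous functions for s > 0 only; the
    point 0 has measure zero and affects neither integrability nor the integral. *)
Lemma integrable_0to_eq f g t : (forall s, 0 < s <= t -> f s = g s) ->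
  integrable_0to f t -> integrable_0to g t /\ integral_0to f t = integral_0to g t.
Proof.
move=> fg fi.
have fg' : {in `]0, t]%classic, EFin \o f =1 EFin \o g}.
  by move=> s; rewrite inE /= in_itv /= => s0; rewrite fg.
have foc : mu.-integrable `]0, t] (EFin \o f).
  apply: integrableS fi => // s /=; rewrite !in_itv /= => /andP[s0 ->].
  by rewrite ltW.
have goc : mu.-integrable `]0, t] (EFin \o g).
  exact: (@eq_integrable _ (measurableTypeR R) R mu _ (measurable_itv _) (EFin \o f)
    (EFin \o g) fg' foc).
split; last first.
  rewrite /integral_0to -!Rintegral_itv_obnd_cbnd //; apply: eq_Rintegral => s.
  by rewrite inE /= in_itv /= => s0; rewrite fg.
have mg := measurable_int mu goc.
have mabs := measurable_int mu (integrable_abse goc).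
apply/integrableP; split; first exact/measurable_realfun.emeasurable_fun_itv_obnd_cbndP.
rewrite -integral_itv_obnd_cbnd; last exact: mabs.
by case/integrableP : goc.
Qed.

Lemma cont_primitive k : cont a k -> exists K, [/\ cont a K, K 0 = 0, der a K k &
  forall k0, (forall t, 0 < t -> (t%:E < a)%E -> k0 t = k t) ->
  forall t, 0 <= t -> (t%:E < a)%E -> integrable_0to k0 t /\ integral_0to k0 t = K t].
Proof.
move=> kc; exists (integral_0to k).
have dK : der a (integral_0to k) k.
  move=> t t0 /(lt_ereal_between)[b tb ba].
  have ta : (t%:E < a)%E by apply: lt_trans ba; rewrite lte_fin.
  have [|d dE] := @continuous_FTC1_closed R k 0 t b tb _ t0 (kc.1 t t0 ta).
    by apply: cont_integrable => //; rewrite ltW // (lt_trans t0).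
  by rewrite -dE derive1E; exact/derivableP.
have K0 : integral_0to k 0 = 0 by rewrite /integral_0to set_itv1 Rintegral_set1.
split=> //.
- split=> [t t0 ta|].
    by have [H _] := dK t t0 ta; exact/differentiable_continuous/derivable1_diffP.
  have [b b0 ba] := lt_ereal_between a_gt0.
  have H := parameterized_integral_continuous (ltW b0) (cont_integrable kc (ltW b0) ba).
  by have [] := (continuous_within_itvP _ b0).1 H.
- move=> k0 k0k t t0 ta.
  have [|i1 ->] := @integrable_0to_eq k k0 t _ (cont_integrable kc t0 ta) => //.
  move=> s /andP[s0 st]; rewrite k0k //.
  by apply: le_lt_trans ta; rewrite lee_fin.
Qed.

Lemma der0_const f : cont a f -> der a f (fun=> 0) ->
  forall t, 0 <= t -> (t%:E < a)%E -> f t = f 0.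
Proof.
move=> fc df t; rewrite le_eqVlt => /predU1P[<- //|t0 ta].
have [|_ _ /eqP] := @MVT R f (fun=> 0) 0 t t0 _ (cont_within_segment fc t0 ta).
  move=> s; rewrite in_itv /= => /andP[s0 st]; apply: df => //.
  by apply: lt_trans ta; rewrite lte_fin.
by rewrite mul0r subr_eq0 => /eqP.
Qed.
End Primitive.

Section Solutions.
Context (R : realType) (a : \bar R) (a_gt0 : (0 < a)%E).
Context (n : nat) (n_ge2 : (2 <= n)%N) (phi w z z1 kap : R -> R).
Implicit Types (t : R).
Local Notation smooth := (iterable a 0).
Local Notation even_smooth := (iterable a 1).
Local Notation m := (n%:R : R).
Local Notation y t := (2 * z t + t ^+ 2 * z1 t).
Local Notation E t := (1 + t ^+ 2 * kap t).
Hypotheses (zi : even_smooth z) (kapi : even_smooth kap).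
Hypothesis factorization : forall t, 0 <= t -> (t%:E < a)%E ->
  [/\ w t = t ^+ 2 * z t, derive_in (Ico0 a) w t = t * y t,
      phi t = (m - 1) * y t * E t, y t != 0 & 0 < E t].

Let m1 : m - 1 != 0.
Proof. by rewrite subr_eq0 gt_eqF // ltr1n. Qed.

(** The quotient phi / ((n-1) w') is E / t = 1 / t + t kap, so subtracting 1 / t removes exactly the
    pole. *)
Lemma r_integrandE t : 0 < t -> (t%:E < a)%E -> r_integrand n a phi w t = t * kap t.
Proof.
move=> t0 ta; have [_ w'E phiE yN0 _] := factorization (ltW t0) ta.
by rewrite /r_integrand w'E phiE; field; rewrite m1 yN0 gt_eqF.
Qed.

Lemma f_integrandE t : 0 < t -> (t%:E < a)%E -> f_integrand n a phi w t = t * (z t * E t).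
Proof.
move=> t0 ta; have [wE w'E phiE yN0 _] := factorization (ltW t0) ta.
by rewrite /f_integrand wE w'E phiE; field; rewrite m1 yN0 gt_eqF.
Qed.

(** The equation for r degenerates at 0, where w' vanishes. For q = r / t it becomes the regular
    equation q' = t kap q with q(0) = r'(0) = 1, so q exp(-K) is constant for the primitive K of t
    kap; this identifies an arbitrary solution with t exp(K). For f the common factor (n-1) t y
    cancels when t > 0 and leaves f' = - t z E. The integrand w r' / r reduces to the same t z E. *)
Lemma r_f_factorization : exists rho F, [/\ even_smooth rho,
   der a rho (fun t => t * (kap t * rho t)), forall t, 0 < rho t, even_smooth F &
   der a F (fun t => t * (z t * E t))] /\
 [/\ r_solution n a phi w (r_explicit n a phi w),
   forall c, f_solution n a phi w (f_explicit n a phi w c) /\ f_explicit n a phi w c 0 = c,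
   forall r, r_solution n a phi w r -> forall t, 0 <= t -> (t%:E < a)%E ->
     [/\ r t = t * rho t, derive_in (Ico0 a) r t = E t * rho t,
       integrable_0to (r_integrand n a phi w) t, r t = r_explicit n a phi w t &
       integrable_0to (fr_integrand a w r) t /\ integral_0to (fr_integrand a w r) t = F t] &
   forall f, f_solution n a phi w f -> forall t, 0 <= t -> (t%:E < a)%E ->
     [/\ f t = - F t + f 0, integrable_0to (f_integrand n a phi w) t &
         f t = f_explicit n a phi w (f 0) t]].
Proof.
have ki : smooth (fun t => t * kap t) by iterable.
have [K [Kc K0 dK KE]] := cont_primitive a_gt0 (iterable_cont ki).
have Ki : even_smooth K by apply: (iterable_prim Kc _ kapi); under eq_fun do rewrite expr1.
have fi : smooth (fun t => t * (z t * E t)) by iterable.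
have [F [Fc F0 dF FE]] := cont_primitive a_gt0 (iterable_cont fi).
have Fi : even_smooth F.
  apply: (iterable_prim Fc (g := fun t => z t * E t)); last by iterable.
  by under eq_fun do rewrite expr1.
pose rho t := expR (K t).
have rhoi : even_smooth rho by apply: iterable_expR.
have drho : der a rho (fun t => t * (kap t * rho t)).
  move=> t t0 ta; have HK := dK t t0 ta; apply: (is_derive_eq (is_derive1_comp _ _)).
  by rewrite /rho; ring.
exists rho, F; split; first by split => // t; exact: expR_gt0.
have r_expl t : 0 <= t -> (t%:E < a)%E -> r_explicit n a phi w t = t * rho t.
  by move=> t0 ta; rewrite /r_explicit (KE _ r_integrandE t t0 ta).2.
have f_expl c t : 0 <= t -> (t%:E < a)%E -> f_explicit n a phi w c t = - F t + c.
  by move=> t0 ta; rewrite /f_explicit (FE _ f_integrandE t t0 ta).2.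
have trhoi : smooth (fun t => t * rho t) by iterable.
have Erhoi : smooth (fun t => E t * rho t) by iterable.
have dr r : (forall t, 0 <= t -> (t%:E < a)%E -> r t = t * rho t) ->
    smooth r /\ forall t, 0 <= t -> (t%:E < a)%E -> derive_in (Ico0 a) r t = E t * rho t.
  move=> rE; have ri : smooth r by apply: iterable_eq trhoi => // t t0 ta; rewrite rE.
  split=> // t t0 ta.
  apply: (@derive_inE R a a_gt0 r (fun t => E t * rho t)) => //; try exact: (iterable_cont (e := 0)).
  apply: (der_eq (f := fun t => t * rho t)).
  - by move=> s s0 sa; rewrite rE // ltW.
  - by move=> s s0 sa; exact: erefl.
  - move=> s s0 sa; have Hr := drho s s0 sa; apply: is_derive_eq.
    by rewrite /GRing.scale /=; ring.
have df f c : (forall t, 0 <= t -> (t%:E < a)%E -> f t = - F t + c) ->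
    smooth f /\ forall t, 0 <= t -> (t%:E < a)%E -> derive_in (Ico0 a) f t = - (t * (z t * E t)).
  move=> fE; have fi' : smooth f.
    apply: (@iterable_eq _ _ a_gt0 _ (fun t => c - F t)); last by iterable.
    by move=> t t0 ta; rewrite fE // addrC.
  split=> // t t0 ta.
  apply: (@derive_inE R a a_gt0 f (fun t => - (t * (z t * E t)))) => //.
  - exact: iterable_cont fi'.
  - under eq_fun do rewrite -mulN1r; apply: (iterable_cont (e := 0)); iterable.
  apply: (der_eq (f := fun t => - F t + c)).
  - by move=> s s0 sa; rewrite fE // ltW.
  - by move=> s s0 sa; exact: erefl.
  - move=> s s0 sa; have Hr := dF s s0 sa; apply: is_derive_eq.
    by rewrite addr0.
split.
- have [ri r'E] := dr _ r_expl; split.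
  + exact: smooth_smooth_in.
  + move=> t [t0 ta]; have [_ w'E phiE _ _] := factorization t0 ta.
    by rewrite r'E // r_expl // w'E phiE; ring.
  + by rewrite /r_explicit mul0r.
  + by rewrite r'E // expr0n mul0r addr0 mul1r /rho K0 expR0.
- move=> c; have [fi' f'E] := df _ _ (f_expl c); split; last by rewrite f_expl // F0 oppr0 add0r.
  split; first exact: smooth_smooth_in.
  move=> t [t0 ta]; have [wE w'E phiE _ _] := factorization t0 ta.
  by rewrite f'E // w'E phiE wE; ring.
- move=> r [/(smooth_in_smooth a_gt0) ri req r0 r'0].
  have [dr' r'i] := smooth_der a_gt0 ri.
  have [q qi [q0 qE]] := smooth_hadamard a_gt0 (iterable_cont ri) r'i dr' r0.
  rewrite r'0 in q0; have [dq q'i] := smooth_der a_gt0 qi.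
  have dr2 : der a r (fun t => q t + t * derive_in (Ico0 a) q t).
    apply: (der_eq (f := fun t => t * q t)).
    - by move=> s s0 sa; rewrite qE // ltW.
    - by move=> s s0 sa; exact: erefl.
    - move=> s s0 sa; have Hr := dq s s0 sa; apply: is_derive_eq.
      by rewrite /GRing.scale /=; ring.
  have q'E t : 0 < t -> (t%:E < a)%E -> derive_in (Ico0 a) q t = t * kap t * q t.
    move=> t0 ta; have [_ w'E phiE yN0 _] := factorization (ltW t0) ta.
    have := req t (conj (ltW t0) ta); rewrite w'E phiE qE ?ltW // => H.
    have H1 := der_unique dr' dr2 t0 ta.
    rewrite H1 in H; move: H; move: (derive_in _ q t) => q'.
    have tN0 : t != 0 by rewrite gt_eqF.
    have -> : (m - 1) * (t * y t) * (q t + t * q') - (m - 1) * y t * E t * (t * q t) =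
      ((m - 1) * y t * (t * t)) * (q' - t * kap t * q t) by ring.
    by move/eqP; rewrite mulf_eq0 !mulf_eq0 (negbTE m1) (negbTE yN0) (negbTE tN0) /= subr_eq0 => /eqP.
  have qrho t : 0 <= t -> (t%:E < a)%E -> q t = rho t.
    move=> t0 ta; pose h t := q t * expR (-1 * K t).
    have hi : smooth h by rewrite /h; iterable.
    have : h t = h 0.
      apply: (der0_const (iterable_cont hi) _ t0 ta) => s s0 sa; have Hq := dq s s0 sa; have HK := dK s s0 sa.
      have HKn : is_derive s 1 (fun t => -1 * K t) (-1 * (s * kap s)).
        by apply: is_derive_eq; rewrite /GRing.scale /=; ring.
      have HE : is_derive s 1 (fun t => expR (-1 * K t)) _ :=
        @is_derive1_comp R expR (fun t => -1 * K t) s _ _ (is_derive_expR _) HKn.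
      apply: is_derive_eq; rewrite /GRing.scale /= q'E //; ring.
    rewrite /h q0 K0 mulr0 expR0 mulr1 mulN1r expRN => H.
    by rewrite /rho -[RHS]mul1r -H divfK // gt_eqF // expR_gt0.
  have rE t : 0 <= t -> (t%:E < a)%E -> r t = t * rho t.
    by move=> t0 ta; rewrite qE // qrho.
  have [_ r'E] := dr r rE.
  move=> t t0 ta; split=> //; [exact: rE | exact: r'E | exact: (KE _ r_integrandE t t0 ta).1 |
     by rewrite r_expl // rE |].
  apply: FE => // s s0 sa; have [wE _ _ _ _] := factorization (ltW s0) sa.
  rewrite /fr_integrand wE r'E ?ltW // rE ?ltW //.
  by field; rewrite /rho gt_eqF ?expR_gt0 // gt_eqF.
- move=> f [/(smooth_in_smooth a_gt0) fi' feq].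
  have [df' f'i] := smooth_der a_gt0 fi'.
  have fE t : 0 <= t -> (t%:E < a)%E -> f t = - F t + f 0.
    move=> t0 ta; have hi : smooth (fun t => f t + F t) by iterable.
    have : f t + F t = f 0 + F 0.
      apply: (der0_const (iterable_cont hi) _ t0 ta) => s s0 sa.
      have Hf := df' s s0 sa; have HF := dF s s0 sa; apply: is_derive_eq.
      have [wE w'E phiE yN0 _] := factorization (ltW s0) sa.
      have := feq s (conj (ltW s0) sa); rewrite w'E phiE wE.
      move: (derive_in _ f s) => f'.
      have -> : (m - 1) * (s * y s) * f' + s ^+ 2 * z s * ((m - 1) * y s * E s) =
        ((m - 1) * s * y s) * (f' + s * (z s * E s)) by ring.
      have sN0 : s != 0 by rewrite gt_eqF.
      by move/eqP; rewrite mulf_eq0 !mulf_eq0 (negbTE m1) (negbTE yN0) (negbTE sN0) /= => /eqP.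
    by rewrite F0 addr0 => <-; ring.
  move=> t t0 ta; split; [exact: fE | exact: (FE _ f_integrandE t t0 ta).1 |].
  by rewrite f_expl // fE.
Qed.
End Solutions.

(** * Radial functions on Euclidean space *)

Section RadialFields.
Context (R : realType) (n : nat).
Implicit Types (x : 'rV[R]_n) (i j : 'I_n) (F G : 'rV[R]_n -> R).
Local Notation ei i := (delta_mx 0 i : 'rV[R]_n).

Lemma enorm_ge0 x : 0 <= enorm x. Proof. exact: sqrtr_ge0. Qed.

Lemma enorm_sqr x : enorm x ^+ 2 = \sum_(i < n) x 0 i ^+ 2.
Proof. by rewrite sqr_sqrtr // sumr_ge0 // => i _; exact: sqr_ge0. Qed.

Lemma enorm0 : enorm (0 : 'rV[R]_n) = 0.
Proof. by apply/eqP; rewrite -sqrf_eq0 enorm_sqr big1 // => i _; rewrite mxE expr0n. Qed.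

Lemma enorm_eq0 x : (enorm x == 0) = (x == 0).
Proof.
apply/eqP/eqP => [x0|->]; last exact: enorm0.
apply/rowP => i; rewrite mxE; apply/eqP; rewrite -sqrf_eq0.
have := enorm_sqr x; rewrite x0 expr0n /= => /esym/eqP.
rewrite psumr_eq0; last by move=> k _; exact: sqr_ge0.
by move/allP => /(_ i); apply; rewrite mem_index_enum.
Qed.

Lemma enorm_gt0 x : (0 < enorm x) = (x != 0).
Proof. by rewrite lt_def enorm_eq0 enorm_ge0 andbT. Qed.

Lemma enorm_line x i (s : R) : enorm (s *: ei i + x) =
  Num.sqrt (s ^+ 2 + 2 * s * x 0 i + enorm x ^+ 2).
Proof.
rewrite enorm_sqr {1}/enorm (bigD1 i) //= [in RHS](bigD1 i) //=.
rewrite !mxE !eqxx mulr1 (eq_bigr (fun k => x 0 k ^+ 2)); last first.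
  by move=> k ki; rewrite !mxE eqxx (negbTE ki) mulr0 add0r.
by congr Num.sqrt; ring.
Qed.

Lemma continuous_coord i : continuous (fun x => x 0 i).
Proof. exact: coord_continuous. Qed.

Lemma continuous_enorm : continuous (@enorm R n).
Proof.
move=> x; apply: (@continuous_comp _ _ _ (fun y : 'rV[R]_n => \sum_(i < n) y 0 i ^+ 2) Num.sqrt);
  last exact: sqrt_continuous.
apply: cvg_big => [||i _]; [exact: add_continuous | exact: (nbhs_filter x) |].
 apply: (@continuous_comp _ _ _ (fun y : 'rV[R]_n => y 0 i) (fun t => t ^+ 2)).
  exact: continuous_coord.
exact: exprn_continuous.
Qed.

Lemma enorm_line_is_derive x i : x != 0 -> is_derive (0 : R) 1
  (fun s => Num.sqrt (s ^+ 2 + 2 * s * x 0 i + enorm x ^+ 2)) (x 0 i / enorm x).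
Proof.
rewrite -enorm_gt0 => x0; pose p (s : R) := s ^+ 2 + 2 * s * x 0 i + enorm x ^+ 2.
have p0 : p 0 = enorm x ^+ 2 by rewrite /p expr0n mulr0 mul0r !add0r.
have dp : is_derive (0 : R) 1 p (2 * x 0 i).
  have HX := is_derive_exprS 1 (0 : R).
  by apply: is_derive_eq; rewrite /GRing.scale /= expr1; ring.
have ds : is_derive (p 0) 1 Num.sqrt (2 * enorm x)^-1.
  have := @is_derive1_sqrt R (p 0); rewrite p0 sqrtr_sqr ger0_norm ?enorm_ge0 //.
  by apply; rewrite exprn_gt0.
apply: (is_derive_eq (is_derive1_comp ds dp)).
by field; rewrite gt_eqF.
Qed.

Lemma is_derive_line x v F (l : R) :
  is_derive (0 : R) 1 (fun s => F (s *: v + x)) l -> is_derive x v (F : _ -> R^o) l.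
Proof.
have E : (fun s : R => s^-1 *: (((F : _ -> R^o) \o shift x) (s *: v) - F x)) =
  (fun s : R => s^-1 *: (((fun s => F (s *: v + x)) \o shift 0) (s *: (1 : R)) - F (0 *: v + x))).
  by apply/funext => s /=; rewrite addr0 scale0r add0r [s *: 1]mulr1.
case=> d dE; split; first by rewrite /derivable E.
by rewrite -dE /derive E.
Qed.

Definition kd i j : R := (i == j)%:R.

Lemma kdC i j : kd i j = kd j i. Proof. by rewrite /kd eq_sym. Qed.

Lemma kdii i : kd i i = 1. Proof. by rewrite /kd eqxx. Qed.

Lemma is_derive_coord x i j : is_derive x (ei i) ((fun y => y 0 j) : _ -> R^o) (kd i j).
Proof.
apply: is_derive_line.
have -> : (fun s : R => (s *: ei i + x) 0 j) = (fun s => kd i j * s + x 0 j).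
  by apply/funext => s; rewrite !mxE eqxx /= eq_sym mulrC.
by apply: is_derive_eq; rewrite addr0 /GRing.scale /= mulr1.
Qed.

Context (a : \bar R) (a_gt0 : (0 < a)%E).
Local Notation U := (@eball R n a).
Local Notation even_smooth := (iterable a 1).

Lemma near_eball x : U x -> \forall y \near x, U y.
Proof.
rewrite /eball /= => /lt_ereal_between[b xb ba].
have H : \forall t \near enorm x, t < b by exact: lt_nbhsl.
have {}H : \forall y \near x, enorm y < b by exact: (@continuous_enorm x _ H).
apply: filterS H => y /= yb.
by apply: lt_trans ba; rewrite lte_fin.
Qed.

Lemma radial_continuous h x : cont a h -> U x -> {for x, continuous (fun y => h (enorm y))}.
Proof.
move=> [hc h0] xU; have [x0|xN0] := eqVneq x 0; last first.
  apply: (@continuous_comp _ _ _ (@enorm R n) h); first exact: continuous_enorm.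
  by apply: hc => //; rewrite enorm_gt0.
suff H : h (enorm y) @[y --> nbhs (0 : 'rV[R]_n)] --> h 0.
  by rewrite x0 /prop_for /continuous_at enorm0.
have FF := nbhs_filter (0 : 'rV[R]_n).
apply/cvgrPdist_lt => eps eps0.
move/cvgrPdist_lt : h0 => /(_ _ eps0)/near0_ball[d d0 Hd].
have H : \forall t \near enorm (0 : 'rV[R]_n), t < d by apply: lt_nbhsl; rewrite enorm0.
have {}H : \forall y \near (0 : 'rV[R]_n), enorm y < d by exact: (@continuous_enorm 0 _ H).
apply: filterS H => y /= yd.
have := enorm_ge0 y; rewrite le_eqVlt => /predU1P[<-|y0]; first by rewrite subrr normr0.
by apply: Hd; rewrite y0.
Qed.

(** Off the origin the weight t cancels the denominator of x_i / t, the derivative of the norm. At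
    the origin h(|s|) = h(0) + s^2 q(|s|), so the difference quotient s q(|s|) tends to 0. *)
Lemma radial_is_derive h h' x i : even_smooth h -> cont a h' ->
  der a h (fun t => t ^+ 1 * h' t) -> U x ->
  is_derive x (ei i) ((fun y => h (enorm y)) : _ -> R^o) (x 0 i * h' (enorm x)).
Proof.
move=> hi h'c dh xU; apply: is_derive_line.
under eq_fun do rewrite enorm_line.
have [x0|xN0] := eqVneq x 0.
  rewrite x0 mxE mul0r enorm0.
  have -> : (fun s : R => h (Num.sqrt (s ^+ 2 + 2 * s * 0 + 0 ^+ 2))) = (fun s => h `|s|).
    by apply/funext => s; rewrite mulr0 expr0n !addr0 sqrtr_sqr.
  have [q qi qE] := even_smooth_expand a_gt0 hi.
  apply/is_derive_diff_quotientP.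
  have nE : \forall s \near (0 : R)^', (`|s|%:E < a)%E.
    have [d d0 Hd] := near0_ball (near0_Ioo a_gt0).
    apply: filterS (dnbhs0_lt d0) => s sd.
    have := normr_ge0 s; rewrite le_eqVlt => /predU1P[<- //|s0].
    by apply: (Hd `|s| _).2; rewrite s0.
  have [_ q0] := iterable_cont qi.
  have norm0 : (@Num.norm R R) @ (0 : R)^' --> 0^'+.
    move=> P /near0_ball[d d0 dP].
    apply: filterS2 (dnbhs0_lt d0) (nbhs_dnbhs_neq 0) => s sd sN0.
    by apply: dP; rewrite normr_gt0 sN0.
  have H : s * q `|s| @[s --> (0 : R)^'] --> 0 * q 0.
    apply: cvgM; first by apply: nbhs_dnbhs.
    exact: cvg_comp norm0 q0.
  rewrite mul0r in H; apply: cvg_trans H; apply: near_eq_cvg.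
  have sN := nbhs_dnbhs_neq (0 : R); near=> s.
  have sa : (`|s|%:E < a)%E by near: s; exact: nE.
  have sN0 : s != 0 by near: s; exact: sN.
  rewrite /diff_quotient normr0 subr0 qE ?normr_ge0 // addrC addKr real_normK ?num_real //.
  by field.
have dsp := enorm_line_is_derive i xN0.
have p0 : Num.sqrt ((0 : R) ^+ 2 + 2 * 0 * x 0 i + enorm x ^+ 2) = enorm x.
  by rewrite expr0n mulr0 mul0r !add0r sqrtr_sqr ger0_norm ?enorm_ge0.
have dh0 : is_derive (Num.sqrt ((0 : R) ^+ 2 + 2 * 0 * x 0 i + enorm x ^+ 2)) 1 h
    (enorm x ^+ 1 * h' (enorm x)).
  by rewrite p0; apply: dh; rewrite ?enorm_gt0.
apply: (is_derive_eq (@is_derive1_comp R h _ 0 _ _ dh0 dsp)).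
by field; rewrite enorm_eq0.
Unshelve. all: by end_near. Qed.

(** Polynomials in the coordinates with even radial coefficients. The class is stable under every
    partial derivative, so all iterated derivatives demanded by [smooth_on] are handled at once. *)
Inductive radial_field : ('rV[R]_n -> R) -> Prop :=
| radial_field_coord i : radial_field (fun x => x 0 i)
| radial_field_even h : even_smooth h -> radial_field (fun x => h (enorm x))
| radial_fieldD F G : radial_field F -> radial_field G -> radial_field (fun x => F x + G x)
| radial_fieldM F G : radial_field F -> radial_field G -> radial_field (fun x => F x * G x).

Lemma radial_field_cst (c : R) : radial_field (fun=> c).
Proof. by apply: (@radial_field_even (fun=> c)); exact: iterable_cst. Qed.

Lemma radial_field_continuous F x : radial_field F -> U x -> {for x, continuous F}.
Proof.
move=> RF xU; elim: RF => {F}.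
- by move=> i; exact: continuous_coord.
- by move=> h hi; apply: radial_continuous => //; exact: iterable_cont hi.
- by move=> F G _ IF _ IG; have FF := nbhs_filter x; apply: cvgD; [exact: IF | exact: IG].
- by move=> F G _ IF _ IG; have FF := nbhs_filter x; apply: cvgM; [exact: IF | exact: IG].
Qed.

Lemma radial_field_is_derive F i : radial_field F -> exists2 F', radial_field F' &
  forall x, U x -> is_derive x (ei i) (F : _ -> R^o) (F' x).
Proof.
elim=> {F}.
- move=> j; exists (fun=> kd i j); first exact: radial_field_cst.
  by move=> x _; exact: is_derive_coord.
- move=> h hi; have [hc [h' h'i dh]] := iterable_unfold hi.
  exists (fun x => x 0 i * h' (enorm x)).
    by apply: radial_fieldM; [exact: radial_field_coord | exact: radial_field_even].
  by move=> x xU; apply: radial_is_derive => //; exact: iterable_cont h'i.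
- move=> F G _ [F' RF' dF] _ [G' RG' dG].
  exists (fun x => F' x + G' x); first exact: radial_fieldD.
  by move=> x xU; apply: is_deriveD; [exact: dF | exact: dG].
- move=> F G RF [F' RF' dF] RG [G' RG' dG].
  exists (fun x => F x * G' x + G x * F' x); first by apply: radial_fieldD; exact: radial_fieldM.
  move=> x xU; have HF := dF x xU; have HG := dG x xU.
  exact: (@is_deriveM _ _ F G x (ei i) _ _ HF HG).
Qed.

Lemma partial_eq F G i x (l : R) : (forall y, U y -> F y = G y) -> U x ->
  is_derive x (ei i) (G : _ -> R^o) l -> derivable (F : _ -> R^o) x (ei i) /\ partial i F x = l.
Proof.
move=> FG xU dG; have : is_derive x (ei i) (F : _ -> R^o) l.
  by apply: near_eq_is_derive dG; apply: filterS (near_eball xU) => y yU; rewrite FG.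
by case.
Qed.

Lemma radial_field_smooth F G : radial_field G -> (forall x, U x -> F x = G x) ->
  smooth_on U F.
Proof.
move=> RG FG s; have {G RG FG} : exists2 G, radial_field G &
    forall x, U x -> foldr (@partial R n) F s x = G x.
  elim: s => [|i s [H RH HE]] /=; first by exists G.
  have [H' RH' dH] := radial_field_is_derive i RH.
  by exists H' => // x xU; have [_] := partial_eq HE xU (dH x xU).
move=> [G RG FG] x xU /=; split; last first.
  move=> i; have [G' RG' dG] := radial_field_is_derive i RG.
  by have [] := partial_eq FG xU (dG x xU).
rewrite /prop_for /continuous_at FG //.
apply: cvg_trans (radial_field_continuous RG xU).
apply: (@near_eq_cvg _ _ _ (nbhs_filter x)).
by apply: filterS (near_eball xU) => y yU; rewrite FG.
Qed.
End RadialFields.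

(** * Ricci curvature of a radial metric *)

Section RadialRicci.
Context (R : realType) (n : nat).
Implicit Types (i j k l : 'I_n) (x : 'rV[R]_n) (t : R).
Local Notation ei i := (delta_mx 0 i : 'rV[R]_n).

Local Notation kd := (@kd R n).
Local Notation kdC := (@kdC R n).
Local Notation kdii := (@kdii R n).

Lemma sum_kd (F : 'I_n -> R) i : \sum_l kd i l * F l = F i.
Proof.
rewrite (bigD1 i) //= kdii mul1r big1 ?addr0 // => l li.
by rewrite /kd eq_sym (negbTE li) mul0r.
Qed.

Lemma sum_coord_sqr x : \sum_l x 0 l * x 0 l = enorm x ^+ 2.
Proof. by rewrite enorm_sqr; apply: eq_bigr => l _; rewrite expr2. Qed.

Lemma sum_kd2 x (G : 'I_n -> R) i j (c0 c1 c2 : R) :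
  \sum_l (c0 * kd i l + c1 * x 0 l + c2 * kd j l) * G l =
  c0 * G i + c1 * (\sum_l x 0 l * G l) + c2 * G j.
Proof.
rewrite -(sum_kd G i) -(sum_kd G j) !mulr_sumr -!big_split /=.
by apply: eq_bigr => l _; ring.
Qed.

(** Normal form for a contraction over i. Later summands are rewritten into this shape, with
    coefficient 0 for the absent monomials. *)
Lemma sum_quadratic x j k (c0 c1 c2 c3 c4 : R) :
  \sum_(i < n) (c0 + c1 * (x 0 i * x 0 i) + c2 * (kd j i * x 0 i) + c3 * (kd k i * x 0 i)
     + c4 * (kd j i * kd k i)) =
  n%:R * c0 + c1 * enorm x ^+ 2 + c2 * x 0 j + c3 * x 0 k + c4 * kd j k.
Proof.
rewrite !big_split /= -!mulr_sumr sum_coord_sqr !sum_kd sumr_const card_ord mulr_natl.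
by rewrite (kdC j k).
Qed.

Definition radial_tensor (A B : R -> R) : tensor2 R n :=
  fun x => \matrix_(i, j) (A (enorm x) * kd i j + B (enorm x) * (x 0 i * x 0 j)).

(** [p], [q] and [s] multiply the three expressions, symmetric in the lower indices i j, that can be
    formed from delta and an odd number of factors x up to degree three. *)
Definition radial_connection (p q s : R -> R) k i j x : R :=
  p (enorm x) * (x 0 i * kd j k + x 0 j * kd i k) + q (enorm x) * (kd i j * x 0 k)
  + s (enorm x) * (x 0 i * (x 0 j * x 0 k)).

Context (a : \bar R) (a_gt0 : (0 < a)%E).
Local Notation U := (@eball R n a).
Local Notation even_smooth := (iterable a 1).

Section Derivatives.
Context (A B A1 B1 : R -> R) (Ai : even_smooth A) (Bi : even_smooth B).
Context (A1i : even_smooth A1) (B1i : even_smooth B1).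
Hypotheses (dA : der a A (fun t => t ^+ 1 * A1 t)) (dB : der a B (fun t => t ^+ 1 * B1 t)).

Lemma partial_radial_tensor i j l x : U x ->
  partial i (fun y => radial_tensor A B y j l) x =
  A1 (enorm x) * (x 0 i * kd j l) + B1 (enorm x) * (x 0 i * (x 0 j * x 0 l))
  + B (enorm x) * (kd i j * x 0 l + kd i l * x 0 j).
Proof.
move=> xU; have HA := radial_is_derive a_gt0 i Ai (iterable_cont A1i) dA xU.
have HB := radial_is_derive a_gt0 i Bi (iterable_cont B1i) dB xU.
have Hj := is_derive_coord x i j; have Hl := is_derive_coord x i l.
apply: (partial_eq (a := a)
  (G := fun y => A (enorm y) * kd j l + B (enorm y) * (y 0 j * y 0 l)) _ xU _).2.
  by move=> y _; rewrite mxE.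
by apply: is_derive_eq; rewrite /GRing.scale /=; ring.
Qed.
End Derivatives.

Lemma partial_radial_connection (p q s p1 q1 s1 : R -> R) (F : 'rV[R]_n -> R) k i j l x :
  even_smooth p -> even_smooth q -> even_smooth s ->
  even_smooth p1 -> even_smooth q1 -> even_smooth s1 ->
  der a p (fun t => t ^+ 1 * p1 t) -> der a q (fun t => t ^+ 1 * q1 t) ->
  der a s (fun t => t ^+ 1 * s1 t) ->
  (forall y, U y -> F y = radial_connection p q s k i j y) -> U x ->
  partial l F x =
    p1 (enorm x) * (x 0 l * (x 0 i * kd j k + x 0 j * kd i k))
    + p (enorm x) * (kd l i * kd j k + kd l j * kd i k)
    + q1 (enorm x) * (x 0 l * (kd i j * x 0 k)) + q (enorm x) * (kd i j * kd l k)
    + s1 (enorm x) * (x 0 l * (x 0 i * (x 0 j * x 0 k)))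
    + s (enorm x) * (kd l i * (x 0 j * x 0 k) + kd l j * (x 0 i * x 0 k) + kd l k * (x 0 i * x 0 j)).
Proof.
move=> pi qi si p1i q1i s1i dp dq ds FE xU.
have Hp := radial_is_derive a_gt0 l pi (iterable_cont p1i) dp xU.
have Hq := radial_is_derive a_gt0 l qi (iterable_cont q1i) dq xU.
have Hs := radial_is_derive a_gt0 l si (iterable_cont s1i) ds xU.
have Hi := is_derive_coord x l i; have Hj := is_derive_coord x l j.
have Hk := is_derive_coord x l k.
apply: (partial_eq FE xU _).2.
by apply: is_derive_eq; rewrite /GRing.scale /=; ring.
Qed.

(* The metric is A (delta + kap x x^T)^2 with A' = 2 t A p and eigenvalue E of
   delta + kap x x^T in the radial direction; p, q, s are the coefficients of its
   Christoffel symbols. *)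
Context (A kap kap1 z z1 : R -> R).
Local Notation E t := (1 + t ^+ 2 * kap t).
Definition conn_p t : R := kap t - E t * z t.
Definition conn_q t : R := (kap t + z t) / E t.
Definition conn_s t : R :=
  (- conn_p t * (2 * kap t + t ^+ 2 * kap t ^+ 2) + kap1 t * E t + kap t ^+ 2) / E t ^+ 2.
Definition metric_B t : R := A t * (2 * kap t + t ^+ 2 * kap t ^+ 2).
Local Notation p := conn_p.
Local Notation q := conn_q.
Local Notation s := conn_s.
Local Notation g := (radial_tensor A metric_B).
Hypotheses (Ai : even_smooth A) (kapi : even_smooth kap) (kap1i : even_smooth kap1).
Hypotheses (zi : even_smooth z) (z1i : even_smooth z1).
Hypothesis (dA : der a A (fun t => t ^+ 1 * (2 * A t * p t))).
Hypothesis (dkap : der a kap (fun t => t ^+ 1 * kap1 t)).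
Hypothesis (dz : der a z (fun t => t ^+ 1 * z1 t)).
Hypothesis AN0 : forall t, 0 <= t -> (t%:E < a)%E -> A t != 0.
Hypothesis EN0 : forall t, 0 <= t -> (t%:E < a)%E -> E t != 0.

Let Ei : even_smooth (fun t => E t). Proof. iterable. Qed.
Let pi : even_smooth p. Proof. rewrite /p; iterable. Qed.
Let Bi : even_smooth metric_B. Proof. rewrite /metric_B; iterable. Qed.
Let EVi : even_smooth (fun t => (E t)^-1). Proof. exact: iterableV. Qed.
Let qi : even_smooth q. Proof. rewrite /q; iterable. Qed.
Let si : even_smooth s.
Proof.
apply: (@iterable_eq _ _ a_gt0 _ (fun t => (-1 * p t * (2 * kap t + t ^+ 2 * kap t ^+ 2)
   + kap1 t * E t + kap t ^+ 2) * (E t)^-1 ^+ 2)); last by iterable.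
by move=> t _ _; rewrite /s exprVn mulN1r.
Qed.

(** The Sherman-Morrison formula for A (I + b x x^T) with b = 2 kap + t^2 kap^2, where 1 + t^2 b =
    E^2. *)
Lemma invmx_radial x k l : U x -> invmx (g x) k l = (A (enorm x))^-1 *
  (kd k l - (2 * kap (enorm x) + enorm x ^+ 2 * kap (enorm x) ^+ 2) / E (enorm x) ^+ 2
    * (x 0 k * x 0 l)).
Proof.
move=> xU; have A0 := AN0 (enorm_ge0 x) xU; have E0 := EN0 (enorm_ge0 x) xU.
pose h : 'M[R]_n := \matrix_(k, l) ((A (enorm x))^-1 * (kd k l -
  (2 * kap (enorm x) + enorm x ^+ 2 * kap (enorm x) ^+ 2) / E (enorm x) ^+ 2 * (x 0 k * x 0 l))).
have gh : g x *m h = 1%:M.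
  apply/matrixP => i j; rewrite !mxE.
  pose c := (2 * kap (enorm x) + enorm x ^+ 2 * kap (enorm x) ^+ 2) / E (enorm x) ^+ 2.
  pose b := 2 * kap (enorm x) + enorm x ^+ 2 * kap (enorm x) ^+ 2.
  rewrite (eq_bigr (fun l => 0 + (- (b * c * x 0 i * x 0 j)) * (x 0 l * x 0 l)
    + (- (c * x 0 j)) * (kd i l * x 0 l) + (b * x 0 i) * (kd j l * x 0 l) + 1 * (kd i l * kd j l))).
    rewrite sum_quadratic -/(kd i j) /c /b; field; exact: E0.
  move=> m _; rewrite !mxE /metric_B -/b -/c (kdC m j); field; exact: A0.
have [gu _] := mulmx1_unit gh.
have -> : invmx (g x) = h by rewrite -[h]mul1mx -(mulVmx gu) -mulmxA gh mulmx1.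
by rewrite mxE.
Qed.

Let dB : der a metric_B (fun t => t ^+ 1 * (2 * A t * p t * (2 * kap t + t ^+ 2 * kap t ^+ 2)
  + A t * (2 * kap1 t + 2 * kap t ^+ 2 + 2 * t ^+ 2 * kap t * kap1 t))).
Proof.
move=> t t0 ta; have HA := dA t0 ta; have Hk := dkap t0 ta; have HX := is_derive_exprS 1 t.
have Hk2 : is_derive t 1 (fun t => kap t ^+ 2) (2 * kap t * (t ^+ 1 * kap1 t)).
  under eq_fun do rewrite expr2.
  by apply: is_derive_eq; rewrite /GRing.scale /=; ring.
by apply: is_derive_eq; rewrite /GRing.scale /= expr1; ring.
Qed.

(** The inverse metric sends x to x / (A E^2). The coefficient of delta_ij x_k is thus (metric_B - A
    p) / (A E^2), and metric_B - A p = A E (kap + z) cancels one factor E, which gives [conn_q]. *)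
Lemma christoffel_radial k i j x : U x -> christoffel g k i j x = radial_connection p q s k i j x.
Proof.
move=> xU; have A0 := AN0 (enorm_ge0 x) xU; have E0 := EN0 (enorm_ge0 x) xU.
have A1i : even_smooth (fun t => 2 * A t * p t) by iterable.
have B1i : even_smooth (fun t => 2 * A t * p t * (2 * kap t + t ^+ 2 * kap t ^+ 2)
  + A t * (2 * kap1 t + 2 * kap t ^+ 2 + 2 * t ^+ 2 * kap t * kap1 t)) by iterable.
have D := fun i j l => partial_radial_tensor Ai Bi A1i B1i dA dB i j l xU.
rewrite /christoffel.
pose T := enorm x; pose LA := 2 * A T * p T.
pose LB := 2 * A T * p T * (2 * kap T + T ^+ 2 * kap T ^+ 2)
  + A T * (2 * kap1 T + 2 * kap T ^+ 2 + 2 * T ^+ 2 * kap T * kap1 T).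
pose c := (2 * kap T + T ^+ 2 * kap T ^+ 2) / E T ^+ 2.
pose S l := LA * (x 0 i * kd j l + x 0 j * kd i l - x 0 l * kd i j) +
   LB * (x 0 i * x 0 j * x 0 l) + 2 * metric_B T * (kd i j * x 0 l).
rewrite (eq_bigr (fun l => ((A T)^-1 * kd k l + (- (A T)^-1 * c * x 0 k) * x 0 l + 0 * kd k l) * S l)).
  rewrite sum_kd2.
  rewrite (eq_bigr (fun l => 0 + (- LA * kd i j + LB * (x 0 i * x 0 j) + 2 * metric_B T * kd i j)
     * (x 0 l * x 0 l) + (LA * x 0 i) * (kd j l * x 0 l) + (LA * x 0 j) * (kd i l * x 0 l)
     + 0 * (kd j l * kd i l))); last by move=> l _; rewrite /S; ring.
  rewrite sum_quadratic /S /radial_connection -/T /c /LA /LB /metric_B /s /q /p.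
  by field; rewrite A0 E0.
move=> l _; rewrite invmx_radial // !D -/T -/LA -/LB -/c /S (kdC l j) (kdC l i) (kdC j i).
by ring.
Qed.

(** Ricci has the form al I + be x x^T. The tangential eigenvalue al and the radial eigenvalue al +
    t^2 be have short expressions and together fix the tensor off the origin, so be itself stays
    existential. *)
Lemma ricci_radial (m := n%:R : R) (y := fun t => 2 * z t + t ^+ 2 * z1 t) x j k : U x ->
  exists be, ricci g x j k = (y (enorm x) / E (enorm x) + (m - 2) *
       (2 * z (enorm x) - enorm x ^+ 2 * z (enorm x) ^+ 2)) * kd j k + be * (x 0 j * x 0 k) /\
    y (enorm x) / E (enorm x) + (m - 2) * (2 * z (enorm x) - enorm x ^+ 2 * z (enorm x) ^+ 2)
      + enorm x ^+ 2 * be = (m - 1) * y (enorm x) * E (enorm x).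
Proof.
move=> xU; have E0 := EN0 (enorm_ge0 x) xU.
pose p1 t := kap1 t - (2 * kap t + t ^+ 2 * kap1 t) * z t - E t * z1 t.
pose q1 t := ((kap1 t + z1 t) * E t - (kap t + z t) * (2 * kap t + t ^+ 2 * kap1 t)) * (E t)^-1 ^+ 2.
have p1i : even_smooth p1 by rewrite /p1; iterable.
have q1i : even_smooth q1 by rewrite /q1; iterable.
have dp : der a p (fun t => t ^+ 1 * p1 t).
  move=> t t0 ta; have Hz := dz t0 ta; have Hk := dkap t0 ta; have HX := is_derive_exprS 1 t.
  by apply: is_derive_eq; rewrite /GRing.scale /= /p1 expr1; ring.
have dq : der a q (fun t => t ^+ 1 * q1 t).
  move=> t t0 ta; have Hz := dz t0 ta; have Hk := dkap t0 ta; have HX := is_derive_exprS 1 t.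
  have Et0 := EN0 (ltW t0) ta.
  have HE : is_derive t 1 (fun t => E t) (t * (2 * kap t + t ^+ 2 * kap1 t)).
    by apply: is_derive_eq; rewrite /GRing.scale /= expr1; ring.
  have HV := @is_deriveV R (fun t => E t) t _ 1 Et0 HE.
  apply: is_derive_eq; rewrite /GRing.scale /= /q1 expr1; field; exact: Et0.
have [_ [s1 s1i ds]] := iterable_unfold si.
have DC l i' j' k' := partial_radial_connection l pi qi si p1i q1i s1i dp dq ds
  (fun y yU => christoffel_radial k' i' j' yU) xU.
pose T := enorm x; pose t2 := T ^+ 2.
pose tau := (m + 1) * p T + q T + t2 * s T.
have trace m' : \sum_i radial_connection p q s i i m' x = tau * x 0 m'.
  rewrite (eq_bigr (fun i => p T * x 0 m' + s T * x 0 m' * (x 0 i * x 0 i)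
    + (p T + q T) * (kd m' i * x 0 i) + 0 * (kd m' i * x 0 i) + 0 * (kd m' i * kd m' i))).
    by rewrite sum_quadratic -/T -/t2 /tau /m; ring.
  by move=> i _; rewrite /radial_connection -/T kdii (kdC i m'); ring.
pose W i k := 2 * p T * (x 0 i * x 0 k) + t2 * (q T * kd i k + s T * (x 0 i * x 0 k)).
have contr i k' : \sum_l x 0 l * radial_connection p q s l i k' x = W i k'.
  rewrite (eq_bigr (fun l => 0 + (q T * kd i k' + s T * (x 0 i * x 0 k')) * (x 0 l * x 0 l)
    + (p T * x 0 k') * (kd i l * x 0 l) + (p T * x 0 i) * (kd k' l * x 0 l) + 0 * (kd i l * kd k' l))).
    by rewrite sum_quadratic -/T -/t2 /W; ring.
  by move=> l _; rewrite /radial_connection -/T; ring.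
pose al := 2 * p T + t2 * q1 T + m * q T - tau + t2 * q T * tau - 2 * t2 * p T * q T.
(* The derivative of tau is t * tau1; it enters through the derivative of the traced connection tau
   * x_k. *)
pose tau1 := (m + 1) * p1 T + q1 T + 2 * s T + t2 * s1 T.
pose be := 2 * p1 T + t2 * s1 T + (m + 2) * s T - tau1 + tau * (2 * p T + t2 * s T)
  - (m + 3) * p T ^+ 2 - 2 * p T * q T - 4 * t2 * p T * s T - q T ^+ 2 - 2 * t2 * q T * s T
  - t2 ^+ 2 * s T ^+ 2.
have alE : al = y T / E T + (m - 2) * (2 * z T - t2 * z T ^+ 2).
  rewrite /al /tau /q1 /s /q /p /y -/T /t2; field; exact: E0.
have beE : al + t2 * be = (m - 1) * y T * E T.
  rewrite /al /be /tau1 /tau /p1 /q1 /s /q /p /y -/T /t2; field; exact: E0.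
exists be; rewrite -/T -/t2 -alE; split; last exact: beE.
pose G := radial_connection p q s.
(* As a covector in l, the first factor is a combination of delta_i, x and delta_j, so the second
   factor need not be expanded. *)
have quadr i : \sum_l G i j l x * G l i k x =
    p T * x 0 j * G i i k x + (p T * kd j i + s T * x 0 j * x 0 i) * W i k + q T * x 0 i * G j i k x.
  rewrite -(contr i k) -sum_kd2; apply: eq_bigr => l _.
  by rewrite /G /radial_connection -/T (kdC l i); ring.
have trquad : \sum_i \sum_l G i i l x * G l j k x = tau * W j k.
  rewrite exchange_big /= -(contr j k) mulr_sumr; apply: eq_bigr => l _.
  by rewrite -mulr_suml trace mulrA.
rewrite /ricci mxE (eq_bigr (fun i => (partial i (christoffel g i j k) x
  - partial j (christoffel g i i k) x - (p T * x 0 j * G i i k x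
     + (p T * kd j i + s T * x 0 j * x 0 i) * W i k + q T * x 0 i * G j i k x))
  + \sum_l G i i l x * G l j k x)); last first.
  move=> i _; rewrite /riemann -quadr -[RHS]addrA; congr (_ + _).
  rewrite addrC -sumrB; apply: eq_bigr => l _.
  by rewrite !christoffel_radial.
rewrite big_split /= trquad.
rewrite (eq_bigr (fun i =>
   (q T * kd j k + s T * (x 0 j * x 0 k) - p1 T * (x 0 j * x 0 k) - p T * kd j k
    - p T ^+ 2 * (x 0 j * x 0 k))
 + (q1 T * kd j k + s1 T * (x 0 j * x 0 k) - s1 T * (x 0 j * x 0 k) - s T * kd j k
    - p T * s T * (x 0 j * x 0 k) - s T * (2 * p T + t2 * s T) * (x 0 j * x 0 k)
    - q T * p T * kd j k - q T * s T * (x 0 j * x 0 k)) * (x 0 i * x 0 i)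
 + (p1 T + s T - 2 * s T - p T * (2 * p T + t2 * s T) - q T * p T) * x 0 k * (kd j i * x 0 i)
 + (p1 T + s T - p1 T - q1 T - p T * (p T + q T) - s T * t2 * q T - q T * q T) * x 0 j * (kd k i * x 0 i)
 + (2 * p T - p T - q T - p T * t2 * q T) * (kd j i * kd k i))).
  by rewrite sum_quadratic -/T -/t2 /W /al /be /tau1 /tau -/m; ring.
move=> i _; rewrite !DC // /G /radial_connection /W -/T !kdii (kdC i j) (kdC i k) (kdC k j).
by ring.
Qed.
End RadialRicci.

(** * Rotationally symmetric tensors *)

Section PolarForms.
Context (R : realType) (n : nat).
Implicit Types (i j k : 'I_n) (x : 'rV[R]_n).
Local Notation ei i := (delta_mx 0 i : 'rV[R]_n).

Lemma enorm_is_derive x i : x != 0 ->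
  is_derive x (ei i) ((@enorm R n) : _ -> R^o) (x 0 i / enorm x).
Proof.
move=> x0; apply: is_derive_line; under eq_fun do rewrite enorm_line.
exact: enorm_line_is_derive.
Qed.

Lemma dt2E x i j : x != 0 -> dt2 x i j = x 0 i * x 0 j / enorm x ^+ 2.
Proof.
move=> xN0; have t0 : enorm x != 0 by rewrite enorm_eq0.
have P k : partial k (@enorm R n) x = x 0 k / enorm x.
  by have [_] := enorm_is_derive k xN0.
by rewrite mxE !P; field.
Qed.

Lemma Theta_is_derive x i k : x != 0 -> is_derive x (ei i) ((@Theta R n k) : _ -> R^o)
  (kd R i k / enorm x - x 0 k * x 0 i / enorm x ^+ 3).
Proof.
move=> xN0; have t0 : enorm x != 0 by rewrite enorm_eq0.
apply: is_derive_line; rewrite /Theta; under eq_fun do rewrite enorm_line.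
pose h (s : R) := Num.sqrt (s ^+ 2 + 2 * s * x 0 i + enorm x ^+ 2).
have h0 : h 0 = enorm x by rewrite /h expr0n mulr0 mul0r !add0r sqrtr_sqr ger0_norm ?enorm_ge0.
have hN0 : h 0 != 0 by rewrite h0.
have dV := @is_deriveV R h 0 _ 1 hN0 (enorm_line_is_derive i xN0).
have -> : (fun s : R => (s *: ei i + x) 0 k / Num.sqrt (s ^+ 2 + 2 * s * x 0 i + enorm x ^+ 2)) =
    (fun s => (kd R i k * s + x 0 k) * (h s)^-1).
  by apply/funext => s; rewrite !mxE eqxx /= eq_sym /h /kd; congr (_ * _); ring.
apply: is_derive_eq; rewrite /GRing.scale /= h0; field; exact: t0.
Qed.

Lemma dTheta2E x i j : x != 0 ->
  dTheta2 x i j = kd R i j / enorm x ^+ 2 - x 0 i * x 0 j / enorm x ^+ 4.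
Proof.
move=> xN0; have t0 : enorm x != 0 by rewrite enorm_eq0.
have P i' k : partial i' (@Theta R n k) x = kd R i' k / enorm x - x 0 k * x 0 i' / enorm x ^+ 3.
  by have [_] := Theta_is_derive i' k xN0.
rewrite mxE (eq_bigr (fun k => 0 + (x 0 i * x 0 j / enorm x ^+ 6) * (x 0 k * x 0 k)
  + (- (x 0 j / enorm x ^+ 4)) * (kd R i k * x 0 k) + (- (x 0 i / enorm x ^+ 4)) * (kd R j k * x 0 k)
  + (enorm x ^+ 2)^-1 * (kd R i k * kd R j k))).
  by rewrite sum_quadratic; field.
by move=> k _; rewrite !P; field.
Qed.

Lemma polar_formE (U : set 'rV[R]_n) (S : tensor2 R n) (P Q : R -> R) : polar_form U S P Q <->
  forall x, U x -> x != 0 -> forall i j, S x i j = P (enorm x) * (x 0 i * x 0 j / enorm x ^+ 2)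
    + Q (enorm x) * (kd R i j / enorm x ^+ 2 - x 0 i * x 0 j / enorm x ^+ 4).
Proof.
split=> [SP x xU x0 i j|SP x xU x0].
  by rewrite SP // mxE [(_ *: dt2 x) _ _]mxE [(_ *: dTheta2 x) _ _]mxE dt2E // dTheta2E.
apply/matrixP => i j; rewrite SP // mxE [(_ *: dt2 x) _ _]mxE [(_ *: dTheta2 x) _ _]mxE.
by rewrite dt2E // dTheta2E.
Qed.

Lemma is_derive_along (F : 'rV[R]_n -> R) (v : 'rV[R]_n) (r : R) :
  derivable (F : _ -> R^o) (r *: v) v ->
  is_derive r 1 (fun s => F (s *: v)) (derive (F : _ -> R^o) (r *: v) v).
Proof.
have E : (fun s : R => s^-1 *: (((F : _ -> R^o) \o shift (r *: v)) (s *: v) - F (r *: v))) =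
  (fun s : R => s^-1 *: (((fun s => F (s *: v)) \o shift r) (s *: (1 : R)) - F (r *: v))).
  by apply/funext => s /=; rewrite [s *: 1]mulr1 scalerDl.
by move=> d; split; rewrite /derivable /derive -E.
Qed.

(** Reversing one axis has determinant -1. Reversing two is the rotation by pi in their plane; it
    maps e_i to - e_i, and its diagonal signs occur squared in the diagonal entries of a
    pullback. *)
Definition half_turn i j : 'M[R]_n :=
  diag_mx (\row_k (if (k == i) || (k == j) then -1 else 1)).

Lemma half_turn_orthogonal i j : i != j -> special_orthogonal (half_turn i j).
Proof.
move=> ij; split.
  rewrite tr_diag_mx mulmx_diag -diag_const_mx; congr diag_mx; apply/rowP => k.
  by rewrite !mxE; case: ifP => _; ring.
rewrite det_diag (bigD1 i) //= (bigD1 j) /=; last by rewrite eq_sym.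
rewrite big1 ?mulr1; last by move=> k /andP[/negbTE ki /negbTE kj]; rewrite mxE ki kj.
by rewrite !mxE !eqxx orbT /= mulrNN mulr1.
Qed.

Lemma half_turn_even (T : tensor2 R n) i j k (s : R) : i != j -> rotationally_symmetric T ->
  T ((- s) *: ei i) k k = T (s *: ei i) k k.
Proof.
move=> ij [_ /(_ _ (half_turn_orthogonal ij)) /(_ (s *: ei i))].
rewrite /pullback_mx tr_diag_mx.
have -> : s *: ei i *m half_turn i j = (- s) *: ei i.
  apply/rowP => l; rewrite mul_mx_diag !mxE eqxx /=.
  by case: eqP => [->|_] /=; rewrite ?mulr1 ?mulr0 ?mul0r //; ring.
move=> <-; rewrite mul_mx_diag mxE mul_diag_mx !mxE.
by case: ifP => _; ring.
Qed.

(** The half turn makes the restriction to the axis even on the whole line. Differentiating this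
    relation m times gives parity (-1)^m for the m-th derivative [H m], so the odd ones vanish at
    0. *)
Lemma diagonal_entry_even (a : \bar R) (T : tensor2 R n) i j k : (0 < a)%E -> i != j ->
  smooth_tensor setT T -> rotationally_symmetric T -> iterable a 1 (fun s => T (s *: ei i) k k).
Proof.
move=> a0 ij Ts Tr.
pose H m (s : R) := foldr (@partial R n) (fun x => T x k k) (nseq m i) (s *: ei i).
have dH (m : nat) (s : R) : is_derive s 1 (H m) (H m.+1 s).
  by apply: is_derive_along; have [_] := Ts k k (nseq m i) (s *: ei i) I; exact.
have Hpar (m : nat) (s : R) : H m (- s) = (-1) ^+ m * H m s.
  elim: m s => [|m IH] s; first by rewrite expr0 mul1r; exact: (half_turn_even k s ij Tr).
  have d1 : is_derive s 1 (fun r => H m (- r)) (- H m.+1 (- s)).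
    have dN : is_derive s 1 (fun r : R => - r) (-1) by apply: is_derive_eq.
    have := @is_derive1_comp R (H m) _ s _ _ (dH m (- s)) dN.
    by rewrite mulrN1.
  have d2 : is_derive s 1 (fun r => (-1) ^+ m * H m r) ((-1) ^+ m * H m.+1 s).
    have := dH m s => Hm; apply: is_derive_eq; rewrite /GRing.scale /=; ring.
  have E : (fun r => H m (- r)) = (fun r => (-1) ^+ m * H m r) by apply/funext => r; exact: IH.
  have := @derive_val _ _ _ _ _ _ _ d1; rewrite E (@derive_val _ _ _ _ _ _ _ d2) => E'.
  by rewrite exprS -mulrA E'; ring.
apply: (@even_smooth_chain R a a0 H) => [m|m t _ _|m om]; last 2 first.
- exact: dH.
- have := Hpar m 0; rewrite oppr0 -signr_odd om expr1 mulN1r => /eqP.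
  by rewrite -addr_eq0 -mulr2n mulrn_eq0 /= => /eqP.
have Hc (s : R) : {for s, continuous (H m)}.
  by have [d _] := dH m s; exact/differentiable_continuous/derivable1_diffP.
by split=> [t _ _|]; [exact: Hc | exact/cvg_at_right_filter/Hc].
Qed.
End PolarForms.

(** * The Riemannian metric and its Ricci tensor compared with polar forms *)

Section Metric.
Context (R : realType) (n : nat).
Implicit Types (i j k : 'I_n) (x v : 'rV[R]_n).
Local Notation ei i := (delta_mx 0 i : 'rV[R]_n).

Lemma enorm_axis i (t : R) : 0 <= t -> enorm (t *: ei i) = t.
Proof.
move=> t0; have := @enorm_line R n 0 i t.
by rewrite addr0 => ->; rewrite mxE mulr0 enorm0 expr0n !addr0 sqrtr_sqr ger0_norm.
Qed.

(** On the axis i, direction i is radial and direction j is tangential, so both profiles are entries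
    of [S]. At t = 0 the polar form is silent and the value of [S] at the origin is used. *)
Lemma polar_form_axis (S : tensor2 R n) (phi psi : R -> R) i j (t : R) : i != j ->
  polar_form setT S phi (fun t => t ^+ 2 * psi t) -> phi 0 = psi 0 -> S 0 = (phi 0)%:M ->
  0 <= t -> S (t *: ei i) i i = phi t /\ S (t *: ei i) j j = psi t.
Proof.
move=> ij /polar_formE SE phi0 S0; rewrite le_eqVlt => /predU1P[<-|t0].
  by rewrite scale0r S0 !mxE !eqxx /= !mulr1n -phi0.
have tN0 : t != 0 by rewrite gt_eqF.
have xN0 : t *: ei i != 0 by rewrite -enorm_gt0 enorm_axis ?ltW.
have ji : (j == i) = false by rewrite eq_sym (negbTE ij).
rewrite !(SE _ I xN0) !enorm_axis ?ltW // !mxE !eqxx ji /= !kdii.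
by split; field.
Qed.

Lemma radial_quadratic_form (A B : R -> R) x v :
  (v *m radial_tensor A B x *m v^T) 0 0 =
  A (enorm x) * enorm v ^+ 2 + B (enorm x) * (\sum_i v 0 i * x 0 i) ^+ 2.
Proof.
set c := \sum_i v 0 i * x 0 i.
have -> : radial_tensor A B x = (A (enorm x))%:M + B (enorm x) *: (x^T *m x).
  apply/matrixP => i j; rewrite !mxE big_ord1 mxE /kd; congr (_ + _).
  by case: eqP => _; rewrite ?mulr1 ?mulr0.
have vx : v *m x^T = c%:M.
  by apply/matrixP => i j; rewrite !ord1 !mxE eqxx mulr1n; apply: eq_bigr => k _; rewrite mxE.
have xv : x *m v^T = c%:M.
  by apply/matrixP => i j; rewrite !ord1 !mxE eqxx mulr1n; apply: eq_bigr => k _; rewrite mxE mulrC.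
rewrite mulmxDr mulmxDl mul_mx_scalar -!scalemxAl -scalemxAr -scalemxAl mulmxA vx -mulmxA xv.
rewrite -scalar_mxM !mxE eqxx mulr1n -expr2; congr (_ * _ + _).
by rewrite -sum_coord_sqr; apply: eq_bigr => k _; rewrite mxE.
Qed.

Context (a : \bar R) (a_gt0 : (0 < a)%E).
Local Notation U := (@eball R n a).
Local Notation even_smooth := (iterable a 1).

(* The quadratic form of the metric at v is A |v + kap <v, x> x|^2. *)
Lemma radial_riemannian_metric (A kap : R -> R) : even_smooth A -> even_smooth kap ->
  (forall t, 0 <= t -> (t%:E < a)%E -> 0 < A t) ->
  (forall t, 0 <= t -> (t%:E < a)%E -> 0 < 1 + t ^+ 2 * kap t) ->
  riemannian_metric U (radial_tensor A (metric_B A kap)).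
Proof.
move=> Ai kapi Apos Epos.
have Bi : even_smooth (metric_B A kap) by rewrite /metric_B; iterable.
split.
- move=> i j; apply: (radial_field_smooth (a := a) a_gt0
    (G := fun x => A (enorm x) * kd R i j + metric_B A kap (enorm x) * (x 0 i * x 0 j))).
    apply: radial_fieldD; apply: radial_fieldM; try exact: radial_field_even.
      exact: radial_field_cst.
    by apply: radial_fieldM; exact: radial_field_coord.
  by move=> x _; rewrite mxE.
- by move=> x _; apply/matrixP => i j; rewrite !mxE (kdC _ j i) (mulrC (x 0 j)).
move=> x xU v vN0; rewrite radial_quadratic_form.
have A0 := Apos _ (enorm_ge0 x) xU; have E0 := Epos _ (enorm_ge0 x) xU.
set c := \sum_i v 0 i * x 0 i; pose K := kap (enorm x).
pose u : 'rV[R]_n := v + (K * c) *: x.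
have uE : enorm u ^+ 2 = enorm v ^+ 2 + 2 * K * c ^+ 2 + (K * c) ^+ 2 * enorm x ^+ 2.
  rewrite -!sum_coord_sqr.
  have -> : 2 * K * c ^+ 2 = \sum_i 2 * K * c * (v 0 i * x 0 i).
    by rewrite -mulr_sumr -/c expr2 mulrA.
  rewrite mulr_sumr -!big_split /=.
  by apply: eq_bigr => i _; rewrite /u !mxE; ring.
have -> : A (enorm x) * enorm v ^+ 2 + metric_B A kap (enorm x) * c ^+ 2 =
    A (enorm x) * enorm u ^+ 2 by rewrite uE /metric_B -/K; ring.
rewrite mulr_gt0 // exprn_gt0 // enorm_gt0; apply: contra vN0 => /eqP u0.
have vE i : v 0 i = - (K * c) * x 0 i.
  by have /matrixP/(_ 0 i) := u0; rewrite /u !mxE => /eqP; rewrite addr_eq0 mulNr => /eqP.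
(* Pairing v = - K c x with x gives c = - K c t^2; as 1 + t^2 K > 0, both c and then v vanish. *)
have : c * (1 + enorm x ^+ 2 * K) = 0.
  have cE : c = - (K * c) * enorm x ^+ 2.
    by rewrite {1}/c -sum_coord_sqr mulr_sumr; apply: eq_bigr => i _; rewrite vE mulrA.
  have -> : c * (1 + enorm x ^+ 2 * K) = c - - (K * c) * enorm x ^+ 2 by ring.
  by rewrite -cE subrr.
move/eqP; rewrite mulf_eq0 (gt_eqF E0) orbF => /eqP c0.
by apply/eqP/rowP => i; rewrite vE c0 mulr0 oppr0 mul0r mxE.
Qed.

Lemma ricci_polar (T : tensor2 R n) (phi psi A kap kap1 z z1 : R -> R) :
  polar_form setT T phi (fun t => t ^+ 2 * psi t) -> phi 0 = psi 0 -> T 0 = (phi 0)%:M ->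
  even_smooth A -> even_smooth kap -> even_smooth kap1 -> even_smooth z -> even_smooth z1 ->
  der a A (fun t => t ^+ 1 * (2 * A t * conn_p kap z t)) ->
  der a kap (fun t => t ^+ 1 * kap1 t) -> der a z (fun t => t ^+ 1 * z1 t) ->
  (forall t, 0 <= t -> (t%:E < a)%E -> 0 < A t) ->
  (forall t, 0 <= t -> (t%:E < a)%E ->
    let y := 2 * z t + t ^+ 2 * z1 t in let E := 1 + t ^+ 2 * kap t in
    [/\ phi t = (n%:R - 1) * y * E, psi t = y / E + (n%:R - 2) * (2 * z t - t ^+ 2 * z t ^+ 2)
      & 0 < E]) ->
  ricci_solution U T (radial_tensor A (metric_B A kap)).
Proof.
move=> /polar_formE TE phi0 T0 Ai kapi kap1i zi z1i dA dkap dz Apos fact.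
split.
  by apply: radial_riemannian_metric => // t t0 ta; have [] := fact t t0 ta.
move=> x xU; have [phiE psiE _] := fact _ (enorm_ge0 x) xU.
apply/matrixP => j k.
have AN0 t : 0 <= t -> (t%:E < a)%E -> A t != 0 by move=> t0 ta; rewrite gt_eqF ?Apos.
have EN0 t : 0 <= t -> (t%:E < a)%E -> 1 + t ^+ 2 * kap t != 0.
  by move=> t0 ta; rewrite gt_eqF //; have [] := fact t t0 ta.
have [be [-> beE]] := ricci_radial a_gt0 Ai kapi kap1i zi z1i dA dkap dz AN0 EN0 j k xU.
(* The relation psi + t^2 be = phi turns psi I + be x x^T into the polar form off the origin; at the
   origin only psi(0) = phi(0) remains. *)
rewrite -psiE; rewrite -psiE -phiE in beE.
have [x0|xN0] := eqVneq x 0.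
  rewrite x0 enorm0 -phi0 T0 !mxE mulr0 mulr0 addr0 /kd.
  by case: eqP => _; rewrite ?mulr1 ?mulr0 ?mulr1n ?mulr0n.
have t0 : enorm x != 0 by rewrite enorm_eq0.
by rewrite (TE x I xN0) -beE; field.
Qed.
End Metric.

(** * Assembly of the solution *)

Unset Implicit Arguments.

Theorem proposition2 (R : realType) (n : nat) (hn : (2 <= n)%N)
    (T : tensor2 R n) (phi psi : R -> R)
    (T_smooth : smooth_tensor setT T)
    (T_rot : rotationally_symmetric T)
    (T_polar : polar_form setT T phi (fun t => t ^+ 2 * psi t))
    (T_origin : phi 0 = psi 0 /\ T 0 = (phi 0)%:M)
    (T_nonsing : nonsingular_tensor setT T)
    (a : \bar R) (a_gt0 : (0 < a)%E)
    (w : R -> R) (hw : w_solution n a phi psi w) :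
  ricci_solvable (eball a) T /\
  (* the explicit functions are solutions, for every constant c *)
  r_solution n a phi w (r_explicit n a phi w) /\
  (forall c : R, f_solution n a phi w (f_explicit n a phi w c) /\
                 f_explicit n a phi w c 0 = c) /\
  (* every pair of solutions gives a metric and has the explicit form *)
  (forall r f : R -> R, r_solution n a phi w r -> f_solution n a phi w f ->
    (exists g : tensor2 R n,
       polar_form (eball a) g
         (fun t => expR (2 * f t) * derive_in (Ico0 a) r t ^+ 2)
         (fun t => expR (2 * f t) * r t ^+ 2) /\
       ricci_solution (eball a) T g) /\
    (forall t : R, Ico0 a t ->
       [/\ integrable_0to (r_integrand n a phi w) t /\ r t = r_explicit n a phi w t,
           integrable_0to (fr_integrand a w r) t /\
             f t = - integral_0to (fr_integrand a w r) t + f 0 &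
           integrable_0to (f_integrand n a phi w) t /\
             f t = f_explicit n a phi w (f 0) t])).
Proof.
pose i0 : 'I_n := Ordinal (ltnW hn); pose i1 : 'I_n := Ordinal hn.
have i01 : i0 != i1 by [].
have [phi0 T0] := T_origin.
have prof t (t0 : 0 <= t) := polar_form_axis i01 T_polar phi0 T0 t0.
have phi_even : iterable a 1 phi.
  apply: (@iterable_eq _ _ a_gt0 _ (fun t => T (t *: delta_mx 0 i0) i0 i0)).
    by move=> t t0 _; rewrite (prof t t0).1.
  exact: diagonal_entry_even a_gt0 i01 T_smooth T_rot.
have psi_even : iterable a 1 psi.
  apply: (@iterable_eq _ _ a_gt0 _ (fun t => T (t *: delta_mx 0 i0) i1 i1)).
    by move=> t t0 _; rewrite (prof t t0).2.
  exact: diagonal_entry_even a_gt0 i01 T_smooth T_rot.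
have phi0N0 : phi 0 != 0.
  have := T_nonsing 0 I; rewrite T0 unitmxE det_scalar unitfE expf_eq0 negb_and.
  by rewrite -leqNgt leqNgt (ltnW hn).
have [z [z1 [kap [zi z1i dz kapi fact]]]] :=
  w_factorization a_gt0 hn phi_even psi_even phi0N0 phi0 hw.
have fact' t : 0 <= t -> (t%:E < a)%E ->
    [/\ w t = t ^+ 2 * z t, derive_in (Ico0 a) w t = t * (2 * z t + t ^+ 2 * z1 t),
      phi t = (n%:R - 1) * (2 * z t + t ^+ 2 * z1 t) * (1 + t ^+ 2 * kap t),
      2 * z t + t ^+ 2 * z1 t != 0 & 0 < 1 + t ^+ 2 * kap t].
  by move=> t0 ta; have [? ? ? _ []] := fact t t0 ta.
have [rho [F [[rhoi drho rho0 Fi dF] [r_expl f_expl r_uniq f_uniq]]]] :=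
  r_f_factorization a_gt0 hn zi kapi fact'.
have [_ [kap1 kap1i dkap]] := iterable_unfold kapi.
have metric r f : r_solution n a phi w r -> f_solution n a phi w f ->
    exists g : tensor2 R n,
       polar_form (eball a) g
         (fun t => expR (2 * f t) * derive_in (Ico0 a) r t ^+ 2)
         (fun t => expR (2 * f t) * r t ^+ 2) /\
       ricci_solution (eball a) T g.
  move=> rS fS; pose A t := expR (2 * (f 0 - F t)) * rho t ^+ 2.
  have A0 t : 0 < A t by rewrite mulr_gt0 ?expR_gt0 // exprn_gt0.
  have Ai : iterable a 1 A by rewrite /A; iterable.
  exists (radial_tensor A (metric_B A kap)); split.
    apply/polar_formE => x xU xN0 i j.
    have t0 : enorm x != 0 by rewrite enorm_eq0.
    have [rE r'E _ _ _] := r_uniq r rS _ (enorm_ge0 x) xU.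
    have [fE _ _] := f_uniq f fS _ (enorm_ge0 x) xU.
    (* Here r' = E rho and r = t rho, and the two forms agree because E^2 - 1 = t^2 (2 kap + t^2
       kap^2). *)
    by rewrite mxE rE r'E fE /metric_B /A (addrC _ (f 0)); field.
  apply: (ricci_polar a_gt0 (phi := phi) (psi := psi) (kap1 := kap1) (z := z) (z1 := z1)) => //.
  (* Logarithmic differentiation of exp(2 f) rho^2: the quotient A' / A is 2 t kap - 2 t z E, which
     is the origin of [conn_p]. *)
  - move=> t t0 ta; have HF := dF t t0 ta; have Hrho := drho t t0 ta.
    have HL : is_derive t 1 (fun t => 2 * (f 0 - F t))
        (- 2 * (t * (z t * (1 + t ^+ 2 * kap t)))).
      by apply: is_derive_eq; rewrite /GRing.scale /=; ring.
    have HE : is_derive t 1 (fun t => expR (2 * (f 0 - F t))) _ :=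
      @is_derive1_comp R expR (fun t => 2 * (f 0 - F t)) t _ _ (is_derive_expR _) HL.
    have Hrho2 : is_derive t 1 (fun t => rho t ^+ 2) (2 * rho t * (t * (kap t * rho t))).
      under eq_fun do rewrite expr2.
      by apply: is_derive_eq; rewrite /GRing.scale /=; ring.
    by apply: is_derive_eq; rewrite /GRing.scale /= /A /conn_p expr1; ring.
  - by move=> t t0 ta y E; have [_ _ ? ? [_ ?]] := fact t t0 ta.
split.
  by have [g [_ gS]] := metric _ _ r_expl (f_expl 0).1; exists g.
split=> //; split=> // r f rS fS; split; first exact: metric.
move=> t [t0 ta]; have [_ _ r_int rE [fr_int frE]] := r_uniq r rS t t0 ta.
have [fE f_int f_explE] := f_uniq f fS t t0 ta.
by split; split=> //; rewrite frE.
Qed.
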